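(* Let $(E,T,S,e)$ be a conditional expectation preserving system. Then the following are equivalent: (1) $(E,T,S,e)$ is weakly mixing, i.e. for all band projections $P,Q$ on $E$, $\frac{1}{n}\sum_{k=0}^{n-1}\left|T\big((S^kPe)\cdot Qe\big)-TPe\cdot TQe\right|\to 0$ in order as $n\to\infty$; (2) for all $f,g\in E_e$, $\frac{1}{n}\sum_{k=0}^{n-1}\left|T\big((S^kf)\cdot g\big)-Tf\cdot Tg\right|\to 0$ in order as $n\to\infty$; (3) for each pair of band projections $P,Q$ on $E$ there is a density zero sequence of band projections $(R_n)_{n\in\mathbb{N}_0}$ on $E$ such that $(I-R_n)\left|T\big((S^nPe)\cdot Qe\big)-TPe\cdot TQe\right|\to 0$ in order as $n\to\infty$.
   Context: Let $E$ be a Dedekind complete Riesz space with weak order unit $e$. A conditional expectation operator on $E$ is a positive order continuous projection $T:E\to E$ whose range is a Dedekind complete Riesz subspace of $E$ and such that $Tu$ is a weak order unit of $E$ for every weak order unit $u$ of $E$. $(E,T,S,e)$ is called a conditional expectation preserving system if $T$ is a conditional expectation operator on $E$ with $Te=e$, and $S$ is an order continuous Riesz homomorphism on $E$ with $Se=e$ and $TSPe=TPe$ for every band projection $P$ on $E$. $E_e=\{f\in E: |f|\le ke \text{ for some } k\in\mathbb{R}_+\}$ is the ideal of $e$-bounded elements; it is an $f$-algebra with unit $e$, whose multiplication $\cdot$ is determined by $Pe\cdot Qe=PQe$ for band projections $P,Q$, extended linearly and by order limits to $E_e$. (The paper writes $T((S^kP)Qe)$ for $T((S^kPe)\cdot Qe)$.)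 A sequence $(R_n)_{n\in\mathbb{N}_0}$ of band projections is of density zero if $\frac{1}{n}\sum_{k=0}^{n-1}R_k\to 0$ in order as $n\to\infty$. $I$ is the identity operator. *)

(* Defs.v *)
From HB Require Import structures.
From mathcomp Require Import all_boot all_order all_algebra.
From mathcomp Require Import reals.
From Stdlib Require Import ClassicalEpsilon.

Set Implicit Arguments.
Unset Strict Implicit.
Unset Printing Implicit Defensive.
Import Order.TTheory GRing.Theory Num.Theory.
Local Open Scope ring_scope.

Section Riesz.
Variables (R : realType) (E : lmodType R) (le : E -> E -> Prop).

Definition is_ub (A : E -> Prop) (u : E) := forall x, A x -> le x u.
Definition is_lb (A : E -> Prop) (u : E) := forall x, A x -> le u x.
Definition is_sup (A : E -> Prop) (s : E) := is_ub A s /\ forall u, is_ub A u -> le s u.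
Definition is_inf (A : E -> Prop) (s : E) := is_lb A s /\ forall u, is_lb A u -> le u s.

Definition riesz_space : Prop :=
  (forall x, le x x) /\
  (forall x y, le x y -> le y x -> x = y) /\
  (forall x y z, le x y -> le y z -> le x z) /\
  (forall x y z, le x y -> le (x + z) (y + z)) /\
  (forall (a : R) x y, 0 <= a -> le x y -> le (a *: x) (a *: y)) /\
  (forall x y, exists s, is_sup (fun z => z = x \/ z = y) s).

Definition dedekind_complete : Prop :=
  forall A : E -> Prop, (exists x, A x) -> (exists u, is_ub A u) ->
    exists s, is_sup A s.

Definition sup2 (x y : E) : E := epsilon (inhabits 0) (is_sup (fun z => z = x \/ z = y)).
Definition inf2 (x y : E) : E := epsilon (inhabits 0) (is_inf (fun z => z = x \/ z = y)).
Definition absv (x : E) : E := sup2 x (- x).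

Definition is_linear (T : E -> E) := forall (a : R) x y, T (a *: x + y) = a *: T x + T y.
Definition positive_op (T : E -> E) := forall x, le 0 x -> le 0 (T x).
Definition down_directed (D : E -> Prop) :=
  forall x y, D x -> D y -> exists z, [/\ D z, le z x & le z y].
(* order continuity of a positive operator: D downward directed, D ↓ 0 implies T(D) ↓ 0 *)
Definition order_continuous (T : E -> E) :=
  forall D : E -> Prop, (exists x, D x) -> down_directed D -> is_inf D 0 ->
    is_inf (fun y => exists2 x, D x & y = T x) 0.

Definition weak_order_unit (u : E) := le 0 u /\ forall f, inf2 (absv f) u = 0 -> f = 0.

Definition in_range (T : E -> E) (f : E) := exists g, f = T g.
Definition riesz_subspace (F : E -> Prop) :=
  [/\ F 0, (forall (a : R) x y, F x -> F y -> F (a *: x + y)) &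
      (forall x y, F x -> F y -> F (sup2 x y))].
Definition dedekind_complete_sub (F : E -> Prop) :=
  forall A : E -> Prop, (forall x, A x -> F x) -> (exists x, A x) ->
    (exists2 u, F u & is_ub A u) ->
    exists2 s, F s & (is_ub A s /\ forall u, F u -> is_ub A u -> le s u).

Definition cond_exp (T : E -> E) :=
  is_linear T /\ positive_op T /\ order_continuous T /\
  (forall f, T (T f) = T f) /\
  riesz_subspace (in_range T) /\ dedekind_complete_sub (in_range T) /\
  (forall u, weak_order_unit u -> weak_order_unit (T u)).

Definition riesz_hom (S : E -> E) :=
  is_linear S /\ forall x y, S (sup2 x y) = sup2 (S x) (S y).

Definition ideal (B : E -> Prop) :=
  [/\ B 0, (forall (a : R) x y, B x -> B y -> B (a *: x + y)) &
      (forall f g, B g -> le (absv f) (absv g) -> B f)].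
Definition band (B : E -> Prop) :=
  ideal B /\ forall (A : E -> Prop) s, (forall x, A x -> B x) -> is_sup A s -> B s.
Definition disj_comp (B : E -> Prop) (f : E) :=
  forall g, B g -> inf2 (absv f) (absv g) = 0.
Definition band_projection (P : E -> E) :=
  exists B, band B /\ forall f, B (P f) /\ disj_comp B (f - P f).

Definition oconv (x : nat -> E) (l : E) :=
  exists p : nat -> E,
    [/\ (forall n, le (p n.+1) (p n)),
        is_inf (fun y => exists n, y = p n) 0 &
        (forall n, le (absv (x n - l)) (p n))].

Definition e_bounded (e f : E) := exists k : R, 0 <= k /\ le (absv f) (k *: e).

(* the f-algebra multiplication on E_e with unit e: bilinear, Pe.Qe = PQe,
   and order continuous in each variable (this determines it uniquely) *)
Definition falg_mult (e : E) (mul : E -> E -> E) :=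
  [/\ (forall (a : R) f g h, e_bounded e f -> e_bounded e g -> e_bounded e h ->
         mul (a *: f + g) h = a *: mul f h + mul g h),
      (forall (a : R) f g h, e_bounded e f -> e_bounded e g -> e_bounded e h ->
         mul h (a *: f + g) = a *: mul h f + mul h g),
      (forall P Q, band_projection P -> band_projection Q -> mul (P e) (Q e) = P (Q e)),
      (forall (f : nat -> E) l g (k : R), (forall n, le (absv (f n)) (k *: e)) ->
         e_bounded e l -> e_bounded e g -> oconv f l ->
         oconv (fun n => mul (f n) g) (mul l g)) &
      (forall (f : nat -> E) l g (k : R), (forall n, le (absv (f n)) (k *: e)) ->
         e_bounded e l -> e_bounded e g -> oconv f l ->
         oconv (fun n => mul g (f n)) (mul g l))].

Definition ceps (T S : E -> E) (e : E) :=
  cond_exp T /\ T e = e /\ riesz_hom S /\ order_continuous S /\ S e = e /\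
  (forall P, band_projection P -> T (S (P e)) = T (P e)).

Definition op_le (U V : E -> E) := forall f, le 0 f -> le (U f) (V f).
Definition order_bounded (U : E -> E) :=
  forall x y, exists w, forall h, le x h -> le h y -> le (absv (U h)) w.
(* U_n -> L in order in L_b(E): |U_n - L| <= W_n with W_n ↓ 0 in L_b(E);
   |V| <= W is written as V <= W and -V <= W *)
Definition op_oconv (U : nat -> E -> E) (L : E -> E) :=
  exists W : nat -> E -> E,
    [/\ (forall n, is_linear (W n) /\ order_bounded (W n)),
        (forall n, op_le (fun _ => 0) (W n)),
        (forall n, op_le (W n.+1) (W n)),
        (forall V, is_linear V -> order_bounded V ->
           (forall n, op_le V (W n)) -> op_le V (fun _ => 0)) &
        (forall n, op_le (fun f => U n f - L f) (W n) /\
                   op_le (fun f => L f - U n f) (W n))].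

Definition density_zero (Rs : nat -> E -> E) :=
  (forall n, band_projection (Rs n)) /\
  op_oconv (fun n f => ((n%:R : R)^-1) *: \sum_(k < n) Rs k f) (fun _ => 0).

End Riesz.

(* Main.v *)
(** (1) <-> (3) is a Koopman-von Neumann lemma for a sequence [f n >= 0] whose
    Cesaro means are dominated by some [p n] decreasing to 0.  Let [s n] be a
    dyadic version of the square root of [p n] and [Rs n] the projection onto the
    band where [f n > s n].  Then [(I - Rs n) (f n) <= s n -> 0], and since [s]
    decreases, [s n] times the mean of the first [n] projections [Rs k] is at most
    [p n], so that this mean is dominated by multiplication by [s n].
    Conversely, operators decreasing to 0 in the order of [L_b(E)] decrease
    to 0 at [e], because their pointwise infimum on the cone is again linear.

    (1) -> (2): the correlation T((S^k f) g) - Tf Tg is bilinear and bounded for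
    the [e]-uniform norm, uniformly in [k], and linear combinations of the [P e]
    are uniformly dense among the [e]-bounded elements (Freudenthal). *)

Require Import Defs.
From mathcomp Require Import all_boot all_order all_algebra.
From mathcomp Require Import reals.
From mathcomp Require Import ring.
From Stdlib Require Import ClassicalEpsilon.
Import Order.TTheory GRing.Theory Num.Theory.
Local Open Scope ring_scope.

(** * Reflexive decision of linear identities in a module *)

(** The obstacle in (1) -> (3) is that there are no points at which to argue, and that density zero
    is a statement about operators, whereas the Cesaro bound concerns elements. Since [p n] need not
    be [e]-bounded, the product on [E_e] gives it no square root; instead [p n] is compared with the
    levels [4^-m e], each comparison yields a band projection, and these are summed with weights
    [2^-m] up to a level that grows with [n]. The resulting operator is defined on all of [E] and
    commutes with every band projection. The bands of the levels cut [E] into finitely many pieces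
    on which this operator is a scalar. On such a piece the scalar can be cancelled from the bound
    on [s n] times the mean, which leaves a bound on the mean at [e]. It passes to the whole
    positive cone because a linear combination of commuting band projections that is nonnegative at
    a weak order unit is nonnegative on every positive element. *)

Inductive vexp (R : Type) :=
  | VVar of nat | VZero | VAdd of vexp R & vexp R | VOpp of vexp R
  | VScale of R & vexp R.
Arguments VVar {R}.
Arguments VZero {R}.
Arguments VAdd {R}.
Arguments VOpp {R}.
Arguments VScale {R}.

Section VecReflect.
Context (R : pzRingType) (E : lmodType R).

Fixpoint veval (env : seq E) (u : vexp R) : E :=
  match u with
  | VVar i => nth 0 env i
  | VZero => 0
  | VAdd u v => veval env u + veval env v
  | VOpp u => - veval env u
  | VScale a u => a *: veval env u
  end.

(** Indices are compared by [Nat.eqb] so that [cbv] evaluates the tests and leaves only identities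
    between scalars, which are then given to [ring]. *)
Fixpoint vcoef (i : nat) (u : vexp R) : R :=
  match u with
  | VVar j => if Nat.eqb i j then 1 else 0
  | VZero => 0
  | VAdd u v => vcoef i u + vcoef i v
  | VOpp u => - vcoef i u
  | VScale a u => a * vcoef i u
  end.

Fixpoint vcoef_eq (n : nat) (u v : vexp R) : Prop :=
  match n with
  | O => True
  | S m => vcoef m u = vcoef m v /\ vcoef_eq m u v
  end.

Lemma veval_sum env u :
  veval env u = \sum_(i < size env) vcoef i u *: nth 0 env i.
Proof.
elim: u => [j||u IHu v IHv|u IHu|a u IHu] /=.
- have eqE (i : nat) : (Nat.eqb i j) = (i == j).
    by apply/idP/eqP => [/PeanoNat.Nat.eqb_eq|->]; rewrite ?PeanoNat.Nat.eqb_refl.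
  case: (ltnP j (size env)) => [lt_j|le_j].
    rewrite (bigD1 (Ordinal lt_j)) //= eqE eqxx scale1r big1 ?addr0 // => i.
    by rewrite eqE -val_eqE /= => /negbTE ->; rewrite scale0r.
  rewrite nth_default // big1 // => i _.
  by rewrite eqE (ltn_eqF (leq_trans (ltn_ord i) le_j)) scale0r.
- by rewrite big1 // => i _; rewrite scale0r.
- by rewrite IHu IHv -big_split; apply: eq_bigr => i _; rewrite scalerDl.
- by rewrite IHu -sumrN; apply: eq_bigr => i _; rewrite scaleNr.
- by rewrite IHu scaler_sumr; apply: eq_bigr => i _; rewrite scalerA.
Qed.

Lemma veval_eq env u v : vcoef_eq (size env) u v -> veval env u = veval env v.
Proof.
rewrite !veval_sum; elim: (size env) => [|n IHn] /=; first by rewrite !big_ord0.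
by move=> [eq_n /IHn eqs]; rewrite !big_ord_recr /= eqs eq_n.
Qed.

End VecReflect.

(* Atoms are compared syntactically, except iterated sums: the additive structure
   of [E] may have been inferred along different paths in two of them. *)
Ltac vec_same x y :=
  lazymatch x with
  | y => constr:(true)
  | @bigop.body _ _ _ _ _ =>
    lazymatch y with
    | @bigop.body _ _ _ _ _ =>
      match goal with
      | _ => let _ := match goal with _ => unify x y end in constr:(true)
      | _ => constr:(false)
      end
    | _ => constr:(false)
    end
  | _ => constr:(false)
  end.
Ltac vec_mem x l :=
  lazymatch l with
  | nil => constr:(false)
  | ?y :: ?l =>
    let b := vec_same x y in
    lazymatch b with true => constr:(true) | false => vec_mem x l end
  end.
Ltac vec_index x l :=
  lazymatch l with
  | ?y :: ?l =>
    let b := vec_same x y in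
    lazymatch b with
    | true => constr:(O)
    | false => let n := vec_index x l in constr:(S n)
    end
  end.
Ltac vec_atoms t l :=
  lazymatch t with
  | @GRing.add _ ?a ?b => let l := vec_atoms a l in vec_atoms b l
  | @GRing.opp _ ?a => vec_atoms a l
  | @GRing.scale _ _ _ ?a => vec_atoms a l
  | @GRing.zero _ => l
  | _ => let b := vec_mem t l in
         lazymatch b with true => l | false => constr:(t :: l) end
  end.
Ltac vec_reify R t l :=
  lazymatch t with
  | @GRing.add _ ?a ?b =>
      let u := vec_reify R a l in let v := vec_reify R b l in constr:(@VAdd R u v)
  | @GRing.opp _ ?a => let u := vec_reify R a l in constr:(@VOpp R u)
  | @GRing.scale _ _ ?c ?a => let u := vec_reify R a l in constr:(@VScale R c u)
  | @GRing.zero _ => constr:(@VZero R)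
  | _ => let n := vec_index t l in constr:(@VVar R n)
  end.
Ltac vec_coefs R E :=
  lazymatch goal with
  | |- ?s = ?t =>
    let l := vec_atoms s (@nil (GRing.Lmodule.sort E)) in
    let l := vec_atoms t l in
    let u := vec_reify (GRing.PzRing.sort R) s l in
    let v := vec_reify (GRing.PzRing.sort R) t l in
    change (@veval R E l u = @veval R E l v);
    apply: veval_eq; cbv [vcoef_eq vcoef size Nat.eqb]; repeat split
  end.
Section RieszTheory.
Set Implicit Arguments.
Unset Strict Implicit.
Context (R : realType) (E : lmodType R) (le : E -> E -> Prop).
Hypothesis riesz : riesz_space le.
Hypothesis dedekind : dedekind_complete le.

Local Notation "x <== y" := (le x y) (at level 70).
Local Notation abs := (absv le).

Ltac vec := vec_coefs R E; try ring.

(** * Order and lattice operations *)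

Lemma vle_refl x : x <== x.
Proof. by case: riesz. Qed.

Lemma vle_anti x y : x <== y -> y <== x -> x = y.
Proof. by case: riesz => _ [anti _]; apply: anti. Qed.

Lemma vle_trans y x z : x <== y -> y <== z -> x <== z.
Proof. by case: riesz => _ [_ [trans _]]; apply: trans. Qed.

Lemma vle_add2r z x y : x <== y -> x + z <== y + z.
Proof. by case: riesz => _ [_ [_ [add _]]]; apply: add. Qed.

Lemma vle_scale (a : R) x y : 0 <= a -> x <== y -> a *: x <== a *: y.
Proof. by case: riesz => _ [_ [_ [_ [scale _]]]]; apply: scale. Qed.

(** Turns a linear inequality into a linear identity: once a suitable combination of known
    inequalities is named, only the equality of the two differences remains to be computed. *)
Lemma vle_of a b x y : a <== b -> b - a = y - x -> x <== y.
Proof.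
move=> le_ab eq_d; have := vle_add2r (x - a) le_ab.
by rewrite addrC subrK addrCA eq_d addrC subrK.
Qed.

Ltac lin H := apply: (vle_of H); vec.

Lemma vle_add x y z t : x <== y -> z <== t -> x + z <== y + t.
Proof.
move=> le_xy le_zt; apply: (vle_trans (vle_add2r z le_xy)).
by lin le_zt.
Qed.

Lemma vle_sub x y : x <== y -> 0 <== y - x.
Proof. by move=> le_xy; lin le_xy. Qed.

Lemma vsub_le x y : 0 <== y - x -> x <== y.
Proof. by move=> le_xy; lin le_xy. Qed.

Lemma vle_addge0 x y : 0 <== x -> 0 <== y -> 0 <== x + y.
Proof. by move=> x0 y0; lin (vle_add x0 y0). Qed.

Lemma vscale_ge0 (a : R) x : 0 <= a -> 0 <== x -> 0 <== a *: x.
Proof. by move=> a0 x0; lin (vle_scale a0 x0). Qed.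

Lemma vle_scalel (a b : R) x : a <= b -> 0 <== x -> a *: x <== b *: x.
Proof.
move=> le_ab x0; have ab0 : 0 <= b - a by rewrite subr_ge0.
by lin (vle_scale ab0 x0).
Qed.

Lemma vle_unscale (a : R) x y : 0 < a -> a *: x <== a *: y -> x <== y.
Proof.
move=> a0 le_xy; have ai0 : 0 <= a^-1 by rewrite invr_ge0 ltW.
by have := vle_scale ai0 le_xy; rewrite !scalerA mulVf ?gt_eqF // !scale1r.
Qed.

Lemma vsum_recr n (f : nat -> E) : \sum_(k < n.+1) f k = \sum_(k < n) f k + f n.
Proof. by rewrite big_ord_recr. Qed.

Lemma vsum_le n (f g : nat -> E) :
  (forall k, (k < n)%N -> f k <== g k) -> \sum_(k < n) f k <== \sum_(k < n) g k.
Proof.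
elim: n => [|n IHn] le_fg; first by rewrite !big_ord0; apply: vle_refl.
rewrite !vsum_recr; apply: vle_add; last by apply: le_fg.
by apply: IHn => k lt_kn; apply/le_fg/(leq_trans lt_kn).
Qed.

Lemma vsum_ge0 n (f : nat -> E) : (forall k, 0 <== f k) -> 0 <== \sum_(k < n) f k.
Proof.
move=> f0; elim: n => [|n IHn]; first by rewrite big_ord0; apply: vle_refl.
by rewrite vsum_recr; apply: vle_addge0.
Qed.

Lemma sup2P x y : is_sup le (fun z => z = x \/ z = y) (sup2 le x y).
Proof.
by apply: epsilon_spec; case: riesz => _ [_ [_ [_ [_ sup]]]]; apply: sup.
Qed.

Lemma le_sup2l x y : x <== sup2 le x y.
Proof. by have [ub _] := sup2P x y; apply: ub; left. Qed.

Lemma le_sup2r x y : y <== sup2 le x y.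
Proof. by have [ub _] := sup2P x y; apply: ub; right. Qed.

Lemma sup2_le x y z : x <== z -> y <== z -> sup2 le x y <== z.
Proof. by have [_ lub] := sup2P x y => ? ?; apply: lub => _ [|] ->. Qed.

Lemma inf2P x y : is_inf le (fun z => z = x \/ z = y) (inf2 le x y).
Proof.
apply: epsilon_spec; exists (- sup2 le (- x) (- y)); split=> [_ [|] ->|u lb].
- by lin (le_sup2l (- x) (- y)).
- by lin (le_sup2r (- x) (- y)).
have : sup2 le (- x) (- y) <== - u.
  apply: sup2_le; first by lin (lb x (or_introl erefl)).
  by lin (lb y (or_intror erefl)).
by move=> H; lin H.
Qed.

Lemma inf2_lel x y : inf2 le x y <== x.
Proof. by have [lb _] := inf2P x y; apply: lb; left. Qed.

Lemma inf2_ler x y : inf2 le x y <== y.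
Proof. by have [lb _] := inf2P x y; apply: lb; right. Qed.

Lemma le_inf2 x y z : z <== x -> z <== y -> z <== inf2 le x y.
Proof. by have [_ glb] := inf2P x y => ? ?; apply: glb => _ [|] ->. Qed.

Definition vpos x := sup2 le x 0.
Definition vneg x := sup2 le (- x) 0.

Lemma vpos_ge0 x : 0 <== vpos x. Proof. exact: le_sup2r. Qed.
Lemma vneg_ge0 x : 0 <== vneg x. Proof. exact: le_sup2r. Qed.
Lemma le_vpos x : x <== vpos x. Proof. exact: le_sup2l. Qed.
Lemma le_vneg x : - x <== vneg x. Proof. exact: le_sup2l. Qed.

Lemma vpos_sub_vneg x : vpos x - vneg x = x.
Proof.
apply: vle_anti.
  have : vpos x <== x + vneg x.
    apply: sup2_le; first by lin (vneg_ge0 x).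
    by lin (le_vneg x).
  by move=> H; lin H.
have : vneg x <== vpos x - x.
  apply: sup2_le; first by lin (vpos_ge0 x).
  by lin (le_vpos x).
by move=> H; lin H.
Qed.

(** Subtracting a common lower bound [m] from [vpos x] still leaves an upper bound of [x] and [0],
    so [m] cannot exceed [0]. *)
Lemma inf2_vpos_vneg x : inf2 le (vneg x) (vpos x) = 0.
Proof.
set m := inf2 le _ _; apply: vle_anti; last by apply: le_inf2; [apply: vneg_ge0|apply: vpos_ge0].
have le_mp : m <== vpos x := inf2_ler _ _.
have le_mn : m <== vneg x := inf2_lel _ _.
have : vpos x <== vpos x - m.
  apply: sup2_le; last by lin le_mp.
  by rewrite -[X in X <== _](vpos_sub_vneg x); lin le_mn.
by move=> H; lin H.
Qed.

Lemma vpos_id x : 0 <== x -> vpos x = x.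
Proof.
move=> x0; apply: vle_anti; last exact: le_vpos.
by apply: sup2_le => //; apply: vle_refl.
Qed.

Lemma vneg_id x : 0 <== x -> vneg x = 0.
Proof.
move=> x0; apply: vle_anti; last exact: vneg_ge0.
by apply: sup2_le; [lin x0|apply: vle_refl].
Qed.

Lemma le_abs x : x <== abs x. Proof. exact: le_sup2l. Qed.
Lemma leN_abs x : - x <== abs x. Proof. exact: le_sup2r. Qed.

Lemma abs_le x y : x <== y -> - x <== y -> abs x <== y.
Proof. exact: sup2_le. Qed.

Lemma abs_ge0 x : 0 <== abs x.
Proof.
have half0 : 0 <= 2^-1 :> R by rewrite invr_ge0.
by apply: (vle_of (vle_scale half0 (vle_add (le_abs x) (leN_abs x)))); vec; field.
Qed.

Lemma abs_id x : 0 <== x -> abs x = x.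
Proof.
move=> x0; apply: vle_anti; last exact: le_abs.
by apply: abs_le; [apply: vle_refl|lin (vle_add x0 x0)].
Qed.

Lemma absN x : abs (- x) = abs x.
Proof.
suff absN_le y : abs (- y) <== abs y.
  by apply: vle_anti => //; rewrite -[x in abs x <== _]opprK.
by apply: abs_le; [apply: leN_abs|rewrite opprK; apply: le_abs].
Qed.

Lemma absD x y : abs (x + y) <== abs x + abs y.
Proof.
apply: abs_le; first exact: vle_add (le_abs x) (le_abs y).
by lin (vle_add (leN_abs x) (leN_abs y)).
Qed.

Lemma absZ (a : R) x : abs (a *: x) <== `|a| *: abs x.
Proof.
case: (leP 0 a) => [a0|/ltW a0]; rewrite ?(ger0_norm a0) ?(ler0_norm a0).
  apply: abs_le; first exact: vle_scale (le_abs x).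
  by lin (vle_scale a0 (leN_abs x)).
have Na0 : 0 <= - a by rewrite oppr_ge0.
apply: abs_le; first by lin (vle_scale Na0 (leN_abs x)).
by lin (vle_scale Na0 (le_abs x)).
Qed.

Lemma vneg_le_abs x : vneg x <== abs x.
Proof. by apply: sup2_le; [apply: leN_abs|apply: abs_ge0]. Qed.

(** * Suprema, infima and decreasing null sequences *)

Definition vsup (A : E -> Prop) : E := epsilon (inhabits 0) (is_sup le A).
Definition vinf (A : E -> Prop) : E := epsilon (inhabits 0) (is_inf le A).

Lemma vsupP (A : E -> Prop) x u : A x -> is_ub le A u -> is_sup le A (vsup A).
Proof. by move=> Ax ub; apply: epsilon_spec; apply: dedekind; [exists x|exists u]. Qed.

Lemma vinfP (A : E -> Prop) x u : A x -> is_lb le A u -> is_inf le A (vinf A).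
Proof.
move=> Ax lb; apply: epsilon_spec.
have [||s [ub lub]] := dedekind (A := fun y => A (- y)).
- by exists (- x); rewrite opprK.
- exists (- u) => y Ay.
  by lin (lb _ Ay).
exists (- s); split=> [y Ay|v lbv].
  have := ub (- y); rewrite opprK => /(_ Ay) H; by lin H.
have : s <== - v by apply: lub => y Ay; lin (lbv _ Ay).
by move=> H; lin H.
Qed.

(** Dedekind completeness gives the multiples of [u], all below [x], a supremum [s]; then [s - u]
    bounds them as well. *)
Lemma archimedean (u x : E) : (forall n, u <== n.+1%:R^-1 *: x) -> u <== 0.
Proof.
move=> le_ux.
have le_nux n : n.+1%:R *: u <== x.
  by have := vle_scale (ler0n R n.+1) (le_ux n); rewrite scalerA mulfV ?pnatr_eq0 // scale1r.
have [||s [ub lub]] := dedekind (A := fun y => exists n, y = n.+1%:R *: u).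
- by exists (1%:R *: u), 0%N.
- by exists x => _ [n ->].
have : s <== s - u.
  apply: lub => _ [n ->]; have := ub (n.+2%:R *: u) (ex_intro _ n.+1 erefl).
  rewrite -natr1 => H.
  by lin H.
by move=> H; lin H.
Qed.

Definition vnull (p : nat -> E) :=
  (forall n, p n.+1 <== p n) /\ is_inf le (fun y => exists n, y = p n) 0.

Lemma vnull_intro p : (forall n, p n.+1 <== p n) -> (forall n, 0 <== p n) ->
  (forall u, (forall n, u <== p n) -> u <== 0) -> vnull p.
Proof.
move=> dec p0 lb; split=> //; split=> [_ [n ->] //|u lbu].
by apply: lb => n; apply: lbu; exists n.
Qed.

Lemma decr_le (p : nat -> E) m n : (forall n, p n.+1 <== p n) -> (m <= n)%N -> p n <== p m.
Proof.
move=> dec /subnK <-; elim: (n - m)%N => [|k IHk]; first exact: vle_refl.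
exact: vle_trans (dec _) IHk.
Qed.

Lemma vnull_le p m n : vnull p -> (m <= n)%N -> p n <== p m.
Proof. by case=> dec _; apply: decr_le. Qed.

Lemma vnull_ge0 p n : vnull p -> 0 <== p n.
Proof. by case=> _ [lb _]; apply: lb; exists n. Qed.

Lemma vnull_lb p u : vnull p -> (forall n, u <== p n) -> u <== 0.
Proof. by case=> _ [_ glb] lbu; apply: glb => _ [n ->]. Qed.

Lemma vnullD p q : vnull p -> vnull q -> vnull (fun n => p n + q n).
Proof.
move=> np nq; apply: vnull_intro => [n|n|u lbu].
- by apply: vle_add; [case: np|case: nq].
- by apply: vle_addge0; apply: vnull_ge0.
suff: forall n, u - p n <== 0.
  by move=> le_up; apply: (vnull_lb np) => n; lin (le_up n).
move=> n; apply: (vnull_lb nq) => m.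
have le1 := vle_trans (lbu (maxn n m)) (vle_add (vnull_le np (leq_maxl n m)) (vnull_le nq (leq_maxr n m))).
by lin le1.
Qed.

Lemma vnullZ (a : R) p : 0 <= a -> vnull p -> vnull (fun n => a *: p n).
Proof.
rewrite le_eqVlt => /orP[/eqP <- _|a0 np].
  apply: vnull_intro => [n|n|u /(_ 0%N)]; rewrite !scale0r //; exact: vle_refl.
apply: vnull_intro => [n|n|u lbu].
- by apply: vle_scale; [apply: ltW|case: np].
- by apply: vscale_ge0; [apply: ltW|apply: vnull_ge0].
apply: (vle_unscale (a := a^-1)); first by rewrite invr_gt0.
rewrite scaler0; apply: (vnull_lb np) => n.
apply: (vle_unscale a0); rewrite scalerA mulfV ?gt_eqF // scale1r.
exact: lbu.
Qed.

Lemma vnull_sum (q : nat -> nat -> E) M : (forall m, vnull (q m)) ->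
  vnull (fun n => \sum_(m < M) q m n).
Proof.
move=> nq; elim: M => [|M [dec [lb glb]]].
  by apply: vnull_intro => [n|n|u /(_ 0%N)]; rewrite !big_ord0 //; apply: vle_refl.
have nS : vnull (fun n => \sum_(m < M) q m n) by [].
have [dec' [lb' glb']] := vnullD nS (nq M).
have sumS n : \sum_(m < M.+1) q m n = \sum_(m < M) q m n + q M n.
  exact: (vsum_recr M (fun m => q m n)).
apply: vnull_intro => [n|n|u le_u]; rewrite ?sumS; first exact: dec'.
  by apply: lb'; exists n.
by apply: glb' => _ [n ->]; rewrite -sumS.
Qed.

Lemma vnull_inv w : 0 <== w -> vnull (fun n => n.+1%:R^-1 *: w).
Proof.
move=> w0; apply: vnull_intro => [n|n|u].
- by apply: vle_scalel w0; rewrite lef_pV2 ?posrE ?ltr0n // ler_nat.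
- by apply: vscale_ge0 => //; rewrite invr_ge0.
- exact: archimedean.
Qed.

(** Replaces a diagonal argument: the pointwise infimum of all bounds [q n + d m] that dominate [x]
    still dominates [x] and decreases, and a lower bound of it lies below every [d m]. *)
Lemma vnull_approx (x d : nat -> E) : (forall n, 0 <== x n) -> vnull d ->
    (forall m, exists2 q, vnull q & forall n, x n <== q n + d m) ->
  exists2 p, vnull p & forall n, x n <== p n.
Proof.
move=> x0 nd approx.
pose A n z := exists m q, [/\ vnull q, forall n, x n <== q n + d m & z = q n + d m].
pose p n := vinf (A n).
have lbx n : is_lb le (A n) (x n) by move=> _ [m [q [_ le_x ->]]].
have infp n : is_inf le (A n) (p n).
  have [q nq le_q] := approx 0%N.
  by apply: (vinfP (x := q n + d 0%N) _ (lbx n)); exists 0%N, q.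
have le_xp n : x n <== p n by have [_ glb] := infp n; apply: glb.
exists p => //; apply: vnull_intro => [n|n|u lbu].
- have [_ glb] := infp n; apply: glb => _ [m [q [nq le_q ->]]].
  have [lb _] := infp n.+1; apply: (vle_trans (y := q n.+1 + d m)).
    by apply: lb; exists m, q.
  by apply: vle_add2r; case: nq.
- exact: vle_trans (le_xp n).
apply: (vnull_lb nd) => m; have [q nq le_q] := approx m.
suff: u - d m <== 0 by move=> H; lin H.
apply: (vnull_lb nq) => n.
have [lb _] := infp n.
have le_pq : p n <== q n + d m by apply: lb; exists m, q.
by lin (vle_trans (lbu n) le_pq).
Qed.

Lemma oconv0E (x : nat -> E) : oconv le x 0 ->
  exists2 p, vnull p & forall n, abs (x n) <== p n.
Proof. by case=> p [dec infp le_xp]; exists p => // n; rewrite -[x n]subr0. Qed.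

Lemma oconv0I (x p : nat -> E) : vnull p ->
  (forall n, 0 <== x n) -> (forall n, x n <== p n) -> oconv le x 0.
Proof.
by move=> [dec infp] x0 le_xp; exists p; split=> // n; rewrite subr0 abs_id.
Qed.

Lemma oconv_ge0 (x : nat -> E) l : (forall n, 0 <== x n) -> oconv le x l -> 0 <== l.
Proof.
move=> x0 [p [dec infp le_xp]]; have np : vnull p by [].
suff: - l <== 0 by move=> H; lin H.
apply: (vnull_lb np) => n.
by lin (vle_add (vle_trans (le_abs _) (le_xp n)) (x0 n)).
Qed.

(** * Cesaro means *)

Definition cesaro (x : nat -> E) (n : nat) : E := n%:R^-1 *: \sum_(k < n) x k.

Lemma cesaro_le x y n : (forall k, (k < n)%N -> x k <== y k) -> cesaro x n <== cesaro y n.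
Proof. by move=> le_xy; apply: vle_scale; [rewrite invr_ge0|apply: vsum_le]. Qed.

Lemma cesaro_ge0 x n : (forall k, 0 <== x k) -> 0 <== cesaro x n.
Proof. by move=> x0; apply: vscale_ge0; [rewrite invr_ge0|apply: vsum_ge0]. Qed.

Lemma cesaroD x y n : cesaro (fun k => x k + y k) n = cesaro x n + cesaro y n.
Proof. by rewrite /cesaro big_split scalerDr. Qed.

Lemma cesaroZ (a : R) x n : cesaro (fun k => a *: x k) n = a *: cesaro x n.
Proof. by rewrite /cesaro -scaler_sumr !scalerA mulrC. Qed.

Lemma cesaro_const_le w n : 0 <== w -> cesaro (fun=> w) n <== w.
Proof.
move=> w0; rewrite /cesaro sumr_const card_ord -scaler_nat scalerA.
case: n => [|n]; first by rewrite mulr0 scale0r.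
by rewrite mulVf ?pnatr_eq0 // scale1r; apply: vle_refl.
Qed.

Lemma cesaro_null q : vnull q -> exists2 p, vnull p & forall n, cesaro q n <== p n.
Proof.
move=> nq; have q0 n : 0 <== q n by apply: vnull_ge0.
apply: (vnull_approx _ nq); first by move=> n; apply: cesaro_ge0.
(* The first [N] terms contribute at most [N / n] times [q 0]. The factor 2 pays for replacing
   [1 / n] by [1 / (n + 1)], which is defined at [n = 0] too. *)
move=> N; exists (fun n => (N%:R * 2) *: (n.+1%:R^-1 *: q 0%N)).
  by apply: vnullZ; [rewrite mulr_ge0|apply: vnull_inv].
have sumE n : \sum_(k < n) q k <== N%:R *: q 0%N + n%:R *: q N.
  suff: \sum_(k < n) q k <== (minn n N)%:R *: q 0%N + n%:R *: q N.
    move=> /vle_trans; apply; apply: vle_add2r; apply: vle_scalel => //.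
    by rewrite ler_nat geq_minr.
  elim: n => [|n IHn].
    by rewrite big_ord0 min0n !scale0r addr0; apply: vle_refl.
  rewrite vsum_recr -natr1; case: (ltnP n N) => [lt_nN|le_Nn].
    move: IHn; rewrite !(minn_idPl _) // 1?ltnW // -natr1 => IHn.
    by lin (vle_add IHn (vle_add (vnull_le nq (leq0n n)) (q0 N))).
  move: IHn; rewrite !(minn_idPr _) // 1?leqW // => IHn.
  by lin (vle_add IHn (vnull_le nq le_Nn)).
case=> [|n].
  rewrite /cesaro invr0 scale0r; apply: vle_addge0 => //.
  by do 2?[apply: vscale_ge0]; rewrite ?mulr_ge0 ?invr_ge0.
have inv0 : 0 <= n.+1%:R^-1 :> R by rewrite invr_ge0.
apply: (vle_trans (vle_scale inv0 (sumE n.+1))).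
rewrite scalerDr [X in _ + X]scalerA mulVf ?pnatr_eq0 // scale1r; apply: vle_add2r.
rewrite !scalerA; apply: vle_scalel => //.
rewrite mulrC -mulrA ler_wpM2l //.
rewrite -[leLHS]mul1r ler_pdivlMr ?ltr0n // mul1r mulrC ler_pdivrMr ?ltr0n //.
by rewrite -natrM ler_nat ?mul2n ?muln2 -addnn addSn addnS !ltnS leq_addl.
Qed.

(** * Linear operators *)

Section LinearOperators.
Context (T : E -> E) (linT : is_linear T).

Lemma linD x y : T (x + y) = T x + T y.
Proof. by have := linT 1 x y; rewrite !scale1r. Qed.

Lemma lin0 : T 0 = 0.
Proof. by apply: (addIr (T 0)); rewrite -linD !add0r. Qed.

Lemma linZ a x : T (a *: x) = a *: T x.
Proof. by have := linT a x 0; rewrite lin0 !addr0. Qed.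

Lemma linN x : T (- x) = - T x.
Proof. by rewrite -!scaleN1r linZ. Qed.

Lemma linB x y : T (x - y) = T x - T y.
Proof. by rewrite linD linN. Qed.

Lemma linS n (f : nat -> E) : T (\sum_(k < n) f k) = \sum_(k < n) T (f k).
Proof.
elim: n => [|n IHn]; first by rewrite !big_ord0 lin0.
by rewrite vsum_recr linD IHn (vsum_recr n (fun k => T (f k))).
Qed.

Hypothesis posT : positive_op le T.

Lemma pos_mono x y : x <== y -> T x <== T y.
Proof. by move=> le_xy; apply: vsub_le; rewrite -linB; apply/posT/vle_sub. Qed.

Lemma pos_abs x : abs (T x) <== T (abs x).
Proof.
by apply: abs_le; [|rewrite -linN]; apply: pos_mono; [apply: le_abs|apply: leN_abs].
Qed.

Lemma pos_order_bounded : order_bounded le T.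
Proof.
move=> x y; exists (abs (T x) + abs (T y)) => h le_xh le_hy; apply: abs_le.
  by lin (vle_add (vle_trans (pos_mono le_hy) (le_abs (T y))) (abs_ge0 (T x))).
by lin (vle_add (vle_add (pos_mono le_xh) (leN_abs (T x))) (abs_ge0 (T y))).
Qed.

End LinearOperators.

(** * Extension of additive maps from the positive cone *)

Definition cone_ext (phi : E -> E) (f : E) : E := phi (vpos f) - phi (vneg f).

Section ConeExtension.
Context (phi : E -> E).
Hypothesis phiD : forall f g, 0 <== f -> 0 <== g -> phi (f + g) = phi f + phi g.
Hypothesis phiZ : forall (a : R) f, 0 <= a -> 0 <== f -> phi (a *: f) = a *: phi f.

(** Any two ways of writing an element as a difference of positive ones agree after cross addition,
    where [phi] is additive; linearity of the extension rests on this freedom. *)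
Lemma cone_extB u v : 0 <== u -> 0 <== v -> cone_ext phi (u - v) = phi u - phi v.
Proof.
move=> u0 v0; rewrite /cone_ext.
have eq_uv : vpos (u - v) + v = vneg (u - v) + u.
  by rewrite -[X in _ = _ + X](subrK v) -[X in _ + (X + _)](vpos_sub_vneg (u - v)); vec.
have := phiD (vpos_ge0 (u - v)) v0; rewrite eq_uv phiD //; last exact: vneg_ge0.
move=> eq_phi.
have -> : phi (vpos (u - v)) = phi (vneg (u - v)) + phi u - phi v by rewrite eq_phi; vec.
by vec.
Qed.

Lemma cone_extE f : 0 <== f -> cone_ext phi f = phi f.
Proof.
move=> f0; rewrite /cone_ext vpos_id // vneg_id //.
have := phiZ (lexx 0) (vle_refl 0); rewrite !scale0r => ->.
by rewrite subr0.
Qed.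

Lemma cone_ext_linear : is_linear (cone_ext phi).
Proof.
move=> a f g.
have [[[fp fn] gp] gn] := (vpos_ge0 f, vneg_ge0 f, vpos_ge0 g, vneg_ge0 g).
have [p [q [p0 q0 eq_pq eq_phi]]] : exists p q, [/\ 0 <== p, 0 <== q,
    a *: f = p - q & phi p - phi q = a *: cone_ext phi f].
  case: (leP 0 a) => [a0|/ltW a0].
    exists (a *: vpos f), (a *: vneg f); split; do ?exact: vscale_ge0.
      by rewrite -{1}(vpos_sub_vneg f); vec.
    by rewrite !phiZ // /cone_ext; vec.
  have Na0 : 0 <= - a by rewrite oppr_ge0.
  exists (- a *: vneg f), (- a *: vpos f); split; do ?exact: vscale_ge0.
    by rewrite -{1}(vpos_sub_vneg f); vec.
  by rewrite !phiZ // /cone_ext; vec.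
rewrite -eq_phi {}eq_pq.
have -> : p - q + g = (p + vpos g) - (q + vneg g).
  by rewrite -{1}(vpos_sub_vneg g); vec.
by rewrite cone_extB ?phiD // ?/cone_ext; do ?exact: vle_addge0; vec.
Qed.

End ConeExtension.

(** * Band projections *)

Lemma inf2C x y : inf2 le x y = inf2 le y x.
Proof. by apply: vle_anti; apply: le_inf2; do ?[exact: inf2_lel | exact: inf2_ler]. Qed.

Lemma inf2_ge0 x y : 0 <== x -> 0 <== y -> 0 <== inf2 le x y.
Proof. exact: le_inf2. Qed.

(** Dividing by [1 + t] brings [y] and [t *: x] below [y] and [x] at once. *)
Lemma inf2_scale_eq0 (t : R) x y : 0 <== x -> 0 <== y -> 0 <= t ->
  inf2 le y x = 0 -> inf2 le y (t *: x) = 0.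
Proof.
move=> x0 y0 t0 xy0.
have tx0 : 0 <== t *: x by apply: vscale_ge0.
have t1 : 0 < 1 + t by rewrite ltr_pwDl.
have z0 := inf2_ge0 y0 tx0; apply: vle_anti => //.
have ti0 : 0 <= (1 + t)^-1 by rewrite invr_ge0 ltW.
apply: (vle_unscale (a := (1 + t)^-1)); first by rewrite invr_gt0.
rewrite scaler0 -xy0; apply: le_inf2.
  apply: vle_trans (inf2_lel y (t *: x)); rewrite -[X in _ <== X]scale1r.
  by apply: vle_scalel => //; rewrite invf_le1 // lerDl.
apply: vle_trans (vle_scale ti0 (inf2_ler y (t *: x))) _.
rewrite scalerA -[X in _ <== X]scale1r; apply: vle_scalel => //.
by rewrite mulrC ler_pdivrMr // mul1r lerDr.
Qed.

Lemma inf2D_le f g h : 0 <== f -> 0 <== g -> 0 <== h ->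
  inf2 le (f + g) h <== inf2 le f h + inf2 le g h.
Proof.
move=> f0 g0 h0; set z := inf2 le (f + g) h.
have [z1 z2] : z <== f + g /\ z <== h by split; [apply: inf2_lel|apply: inf2_ler].
suff: z - inf2 le f h <== inf2 le g h by move=> H; lin H.
have fh0 := inf2_ge0 f0 h0.
apply: le_inf2; last by lin (vle_add z2 fh0).
suff: z - g <== inf2 le f h by move=> H; lin H.
by apply: le_inf2; [lin z1|lin (vle_add z2 g0)].
Qed.

(** The algebraic form of a band projection, a linear idempotent between [0] and the identity on the
    cone. It mentions no band; the band is recovered as the set of fixed points. *)
Definition bp (P : E -> E) : Prop :=
  [/\ is_linear P, positive_op le P, (forall f, 0 <== f -> P f <== f) &
      forall f, P (P f) = P f].

Lemma abs_eq0 x : abs x = 0 -> x = 0.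
Proof.
move=> x0; apply: vle_anti; first by rewrite -x0; apply: le_abs.
by have := leN_abs x; rewrite x0 => H; lin H.
Qed.

Section BandDecomposition.
Context (B : E -> Prop) (idealB : ideal le B).

Lemma disj_comp_linear (a : R) u v :
  disj_comp le B u -> disj_comp le B v -> disj_comp le B (a *: u + v).
Proof.
move=> du dv g Bg; apply: vle_anti; last by apply: inf2_ge0; apply: abs_ge0.
have a0 : 0 <= `|a| by [].
have [[u0 v0] g0] := (abs_ge0 u, abs_ge0 v, abs_ge0 g).
apply: (vle_trans (y := inf2 le (`|a| *: abs u + abs v) (abs g))).
  apply: le_inf2; last exact: inf2_ler.
  apply: vle_trans (inf2_lel _ _) _; apply: vle_trans (absD _ _) _.
  by apply: vle_add2r; apply: absZ.
apply: vle_trans (inf2D_le _ v0 g0) _; first exact: vscale_ge0.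
rewrite (dv _ Bg) inf2C inf2_scale_eq0 ?addr0 //; first exact: vle_refl.
by rewrite inf2C; apply: du.
Qed.

Lemma band_disjoint_eq0 u : B u -> disj_comp le B u -> u = 0.
Proof.
move=> Bu /(_ u Bu) u0; apply/abs_eq0/vle_anti; last exact: abs_ge0.
by rewrite -[X in _ <== X]u0; apply: le_inf2; apply: vle_refl.
Qed.

End BandDecomposition.

(** All four properties come from disjointness: linearity and idempotence from uniqueness of the
    decomposition along the band, the two inequalities from the fact that disjoint elements with a
    positive sum are both positive. *)
Lemma band_projection_bp P : band_projection le P -> bp P.
Proof.
case=> B [[idealB _] decB].
have BP f : B (P f) by case: (decB f).
have dP f : disj_comp le B (f - P f) by case: (decB f).
have [B0 Blin _] := idealB.
have BB x y : B x -> B y -> B (x - y).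
  by move=> Bx By; rewrite addrC -scaleN1r; apply: Blin.
have dB x y : disj_comp le B x -> disj_comp le B y -> disj_comp le B (x - y).
  by move=> dx dy; rewrite addrC -scaleN1r; apply: disj_comp_linear.
have uniqP x y : B x -> B y -> disj_comp le B (x - y) -> x = y.
  by move=> Bx By dxy; apply/eqP; rewrite -subr_eq0; apply/eqP; apply: (band_disjoint_eq0 (BB _ _ Bx By) dxy).
have neg_eq0 u v : 0 <== u + v -> inf2 le (abs u) (abs v) = 0 -> 0 <== u.
  move=> uv0 uv; suff n0 : vneg u = 0.
    by rewrite -(vpos_sub_vneg u) n0 subr0; apply: vpos_ge0.
  apply: vle_anti; last exact: vneg_ge0.
  rewrite -uv; apply: le_inf2; first exact: vneg_le_abs.
  apply: sup2_le; last exact: abs_ge0.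
  by apply: vle_trans (le_abs v); lin uv0.
split=> [a f g|f f0|f f0|f].
- apply: uniqP; [exact: BP|exact: Blin|].
  have -> : P (a *: f + g) - (a *: P f + P g)
          = (a *: (f - P f) + (g - P g)) - ((a *: f + g) - P (a *: f + g)) by vec.
  by apply: (dB _ _ _ (dP _)); apply: disj_comp_linear.
- apply: (neg_eq0 _ (f - P f)); first by lin f0.
  by rewrite inf2C; apply: dP.
- apply: vsub_le; apply: (neg_eq0 _ (P f)); first by lin f0.
  exact: dP.
apply: uniqP => //.
have -> : P (P f) - P f = 0 - (P f - P (P f)) by vec.
apply: (dB _ _ _ (dP _)) => g Bg; rewrite (abs_id (vle_refl 0)).
apply: vle_anti; first exact: inf2_lel.
by apply: inf2_ge0; [apply: vle_refl|apply: abs_ge0].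
Qed.

Section BpTheory.
Context (P : E -> E) (bpP : bp P).

Lemma bp_lin : is_linear P. Proof. by case: bpP. Qed.
Lemma bp_pos : positive_op le P. Proof. by case: bpP. Qed.
Lemma bp_le f : 0 <== f -> P f <== f. Proof. by case: bpP => _ _ leP _; apply: leP. Qed.
Lemma bp_idem f : P (P f) = P f. Proof. by case: bpP. Qed.
Lemma bp_mono x y : x <== y -> P x <== P y.
Proof. exact: (pos_mono bp_lin bp_pos). Qed.

Lemma bp_compl : bp (fun f => f - P f).
Proof.
split=> [a f g|f f0|f f0|f].
- by rewrite bp_lin; vec.
- exact/vle_sub/bp_le.
- by lin (bp_pos f0).
- by rewrite (linB bp_lin) bp_idem; vec.
Qed.

Lemma bp_band_projection : band_projection le P.
Proof.
exists (fun f => P f = f).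
have linP := bp_lin; have [linC posC _ _] := bp_compl.
have absP g : P g = g -> P (abs g) = abs g.
  move=> Pg; apply: vle_anti; first exact/bp_le/abs_ge0.
  by rewrite -[in X in X <== _]Pg; apply: (pos_abs linP bp_pos).
have solid f g : P g = g -> abs f <== abs g -> P f = f.
  move=> Pg le_fg; apply/esym/eqP; rewrite -subr_eq0; apply/eqP/abs_eq0.
  apply: vle_anti; last exact: abs_ge0.
  apply: vle_trans (pos_abs linC posC f) _.
  apply: vle_trans (pos_mono linC posC le_fg) _.
  by rewrite absP // subrr; apply: vle_refl.
split; first split; first split.
- exact: lin0 linP.
- by move=> a x y Px Py; rewrite linP Px Py.
- by move=> f g Pg le_fg; apply: solid Pg le_fg.
- move=> A s PA [ub lub]; case: (classic (exists x, A x)) => [[x Ax]|nA].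
    apply: vle_anti; last by apply: lub => y Ay; rewrite -(PA y Ay); apply/bp_mono/ub.
    by apply: vsub_le; have := posC _ (vle_sub (ub x Ax)); rewrite (linB linP) (PA x Ax) => H; lin H.
  (* A supremum of the empty set is a least element of [E], which forces it to be [0]. *)
  have least u : s <== u by apply: lub => y Ay; case: nA; exists y.
  have -> : s = 0 by apply: vle_anti => //; lin (least (s + s)).
  exact: lin0 linP.
move=> f; split; first exact: bp_idem.
move=> g Pg; set h := inf2 le _ _.
have h0 : 0 <== h by apply: inf2_ge0; apply: abs_ge0.
have Ph : P h = h.
  by apply: (solid _ g Pg); rewrite abs_id //; apply: inf2_ler.
apply: vle_anti => //; rewrite -Ph.
apply: vle_trans (bp_mono (inf2_lel _ _)) _.
apply: vle_trans (bp_mono (pos_abs linC posC f)) _.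
by rewrite (linB linP) bp_idem subrr; apply: vle_refl.
Qed.

End BpTheory.

Lemma bp_id : bp id.
Proof. by split=> // f _; apply: vle_refl. Qed.

Lemma lin_eq_pos (T U : E -> E) : is_linear T -> is_linear U ->
  (forall f, 0 <== f -> T f = U f) -> forall f, T f = U f.
Proof.
move=> linT linU eqTU f; rewrite -(vpos_sub_vneg f) (linB linT) (linB linU).
by rewrite !eqTU //; [apply: vneg_ge0|apply: vpos_ge0].
Qed.

Lemma lin_comp (T U : E -> E) : is_linear T -> is_linear U -> is_linear (fun f => T (U f)).
Proof. by move=> linT linU a f g; rewrite linU linT. Qed.

Lemma bp_comm P Q : bp P -> bp Q -> forall f, P (Q f) = Q (P f).
Proof.
have half P' Q' f : bp P' -> bp Q' -> 0 <== f -> P' (Q' f) <== Q' (P' f).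
  (* [P (Q f)] lies between [0] and [Q f], hence is fixed by [Q]; applying [Q] to [P (Q f) <== P f]
     gives the inequality. *)
  move=> bP bQ f0; have bCQ := bp_compl bQ.
  have PQf : P' (Q' f) = Q' (P' (Q' f)).
    apply/eqP; rewrite -subr_eq0; apply/eqP; apply: vle_anti.
      apply: vle_trans (bp_mono bCQ (bp_le bP (bp_pos bQ f0))) _.
      by rewrite bp_idem // subrr; apply: vle_refl.
    exact: (bp_pos bCQ (bp_pos bP (bp_pos bQ f0))).
  by rewrite PQf; exact: (bp_mono bQ (bp_mono bP (bp_le bQ f0))).
move=> bP bQ; apply: (lin_eq_pos (lin_comp (bp_lin bP) (bp_lin bQ)) (lin_comp (bp_lin bQ) (bp_lin bP))) => f f0.
by apply: vle_anti; [exact: (half P Q)|exact: (half Q P)].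
Qed.

Lemma bp_comp P Q : bp P -> bp Q -> bp (fun f => P (Q f)).
Proof.
move=> bP bQ; split=> [|f f0|f f0|f].
- exact: lin_comp (bp_lin bP) (bp_lin bQ).
- exact: (bp_pos bP (bp_pos bQ f0)).
- by apply: vle_trans (bp_le bP (bp_pos bQ f0)) (bp_le bQ f0).
- by rewrite (bp_comm bQ bP) bp_idem // bp_idem.
Qed.

(** * The band projection generated by a positive element *)

Definition pproj_pos (x f : E) : E :=
  vsup (fun y => exists2 t : R, 0 <= t & y = inf2 le f (t *: x)).

Definition pproj (x : E) : E -> E := cone_ext (pproj_pos x).

Section PrincipalProjection.
Context (x : E) (x0 : 0 <== x).

Lemma pproj_posP f : 0 <== f ->
  is_sup le (fun y => exists2 t : R, 0 <= t & y = inf2 le f (t *: x)) (pproj_pos x f).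
Proof.
move=> f0; apply: (vsupP (x := inf2 le f (0 *: x)) (u := f)); first by exists 0.
by move=> _ [t t0 ->]; apply: inf2_lel.
Qed.

Lemma inf2_le_pproj_pos (t : R) f : 0 <== f -> 0 <= t -> inf2 le f (t *: x) <== pproj_pos x f.
Proof. by move=> f0 t0; have [ub _] := pproj_posP f0; apply: ub; exists t. Qed.

Lemma pproj_pos_lub f u : 0 <== f ->
  (forall t : R, 0 <= t -> inf2 le f (t *: x) <== u) -> pproj_pos x f <== u.
Proof.
by move=> f0 le_u; have [_ lub] := pproj_posP f0; apply: lub => _ [t t0 ->]; apply: le_u.
Qed.

Lemma pproj_pos_ge0 f : 0 <== f -> 0 <== pproj_pos x f.
Proof.
move=> f0; apply: vle_trans (inf2_le_pproj_pos f0 (lexx 0)).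
by apply: inf2_ge0; rewrite ?scale0r //; apply: vle_refl.
Qed.

Lemma pproj_pos_le f : 0 <== f -> pproj_pos x f <== f.
Proof. by move=> f0; apply: pproj_pos_lub => // t _; apply: inf2_lel. Qed.

(** One inequality is the subadditivity of the infimum. For the other, two truncations at heights
    [t] and [s] add up to at most the truncation of [f + g] at height [t + s], and the two suprema
    are taken one after the other. *)
Lemma pproj_posD f g : 0 <== f -> 0 <== g ->
  pproj_pos x (f + g) = pproj_pos x f + pproj_pos x g.
Proof.
move=> f0 g0; have fg0 := vle_addge0 f0 g0; apply: vle_anti.
  apply: pproj_pos_lub => // t t0; apply: vle_trans (inf2D_le f0 g0 (vscale_ge0 t0 x0)) _.
  by apply: vle_add; apply: inf2_le_pproj_pos.
suff: pproj_pos x f <== pproj_pos x (f + g) - pproj_pos x g by move=> H; lin H.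
apply: pproj_pos_lub => // t t0.
suff: pproj_pos x g <== pproj_pos x (f + g) - inf2 le f (t *: x) by move=> H; lin H.
apply: pproj_pos_lub => // s s0.
suff: inf2 le f (t *: x) + inf2 le g (s *: x) <== pproj_pos x (f + g) by move=> H; lin H.
apply: vle_trans (inf2_le_pproj_pos fg0 (addr_ge0 t0 s0)).
apply: le_inf2; first exact: vle_add (inf2_lel _ _) (inf2_lel _ _).
by rewrite scalerDl; apply: vle_add; apply: inf2_ler.
Qed.

Lemma pproj_posZ (a : R) f : 0 <= a -> 0 <== f -> pproj_pos x (a *: f) = a *: pproj_pos x f.
Proof.
have half (b : R) g : 0 < b -> 0 <== g -> pproj_pos x (b *: g) <== b *: pproj_pos x g.
  move=> b0 g0; have bi0 : 0 <= b^-1 by rewrite invr_ge0 ltW.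
  apply: pproj_pos_lub => [|t t0]; first by apply: vscale_ge0 => //; apply: ltW.
  apply: (vle_unscale (a := b^-1)); first by rewrite invr_gt0.
  rewrite [X in _ <== X]scalerA mulVf ?gt_eqF // scale1r.
  apply: vle_trans (inf2_le_pproj_pos g0 (mulr_ge0 bi0 t0)).
  apply: le_inf2.
    rewrite -[X in _ <== X](scale1r g) -(mulVf (x := b)) ?gt_eqF // -scalerA.
    by apply: vle_scale => //; apply: inf2_lel.
  by rewrite -scalerA; apply: vle_scale => //; apply: inf2_ler.
rewrite le_eqVlt => /orP[/eqP <- _|a0 f0].
  rewrite !scale0r; apply: vle_anti; first exact/pproj_pos_le/vle_refl.
  exact/pproj_pos_ge0/vle_refl.
apply: vle_anti; first exact: half.
have af0 := vscale_ge0 (ltW a0) f0.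
apply: (vle_unscale (a := a^-1)); first by rewrite invr_gt0.
rewrite scalerA mulVf ?gt_eqF // scale1r -[f in X in X <== _](scale1r f).
rewrite -(mulVf (x := a)) ?gt_eqF // -scalerA.
by apply: half => //; rewrite invr_gt0.
Qed.

Lemma pprojE f : 0 <== f -> pproj x f = pproj_pos x f.
Proof. exact: (cone_extE pproj_posZ). Qed.

Lemma pproj_bp : bp (pproj x).
Proof.
have linP : is_linear (pproj x) := cone_ext_linear pproj_posD pproj_posZ.
split=> // [f f0|f f0|].
- by rewrite pprojE //; apply: pproj_pos_ge0.
- by rewrite pprojE //; apply: pproj_pos_le.
apply: (lin_eq_pos (lin_comp linP linP) linP) => f f0.
have pf0 := pproj_pos_ge0 f0; rewrite !pprojE //.
apply: vle_anti; first exact: pproj_pos_le.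
apply: pproj_pos_lub => // t t0; apply: vle_trans (inf2_le_pproj_pos pf0 t0).
by apply: le_inf2; [apply: inf2_le_pproj_pos|apply: inf2_ler].
Qed.

Lemma pproj_self : pproj x x = x.
Proof.
rewrite pprojE //; apply: vle_anti; first exact: pproj_pos_le.
by apply: vle_trans (inf2_le_pproj_pos x0 ler01); apply: le_inf2; rewrite ?scale1r; apply: vle_refl.
Qed.

Lemma pproj_disjoint y : 0 <== y -> inf2 le y x = 0 -> pproj x y = 0.
Proof.
move=> y0 yx0; rewrite pprojE //; apply: vle_anti; last exact: pproj_pos_ge0.
by apply: pproj_pos_lub => // t t0; rewrite inf2_scale_eq0 //; apply: vle_refl.
Qed.

End PrincipalProjection.

Lemma pproj_le x y f : 0 <== x -> x <== y -> 0 <== f -> pproj x f <== pproj y f.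
Proof.
move=> x0 le_xy f0; have y0 := vle_trans x0 le_xy; rewrite !pprojE //.
apply: pproj_pos_lub => // t t0; apply: vle_trans (inf2_le_pproj_pos _ f0 t0).
apply: le_inf2; first exact: inf2_lel.
exact: vle_trans (inf2_ler _ _) (vle_scale t0 le_xy).
Qed.

(* [pspan z] projects onto the band on which [z] is strictly positive. *)
Definition pspan (z : E) : E -> E := pproj (vpos z).

Lemma pspan_bp z : bp (pspan z).
Proof. exact/pproj_bp/vpos_ge0. Qed.

Lemma pspan_self z : pspan z z = vpos z.
Proof.
rewrite -{2}(vpos_sub_vneg z) (linB (bp_lin (pspan_bp z))) /pspan.
rewrite pproj_self; last exact: vpos_ge0.
by rewrite pproj_disjoint ?subr0 //; [apply: vpos_ge0|apply: vneg_ge0|apply: inf2_vpos_vneg].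
Qed.

Lemma pspan_ge0 z : 0 <== pspan z z.
Proof. by rewrite pspan_self; apply: vpos_ge0. Qed.

Lemma pspan_compl_le0 z : z - pspan z z <== 0.
Proof. by rewrite pspan_self; lin (le_vpos z). Qed.

Lemma vpos_mono x y : x <== y -> vpos x <== vpos y.
Proof.
move=> le_xy; apply: sup2_le; last exact: vpos_ge0.
exact: vle_trans le_xy (le_vpos y).
Qed.

Lemma pspan_le x y f : x <== y -> 0 <== f -> pspan x f <== pspan y f.
Proof. by move=> le_xy f0; apply: pproj_le (vpos_ge0 _) (vpos_mono le_xy) f0. Qed.

Lemma bp_absorb P Q : bp P -> bp Q -> (forall f, 0 <== f -> P f <== Q f) ->
  forall f, Q (P f) = P f.
Proof.
move=> bP bQ le_PQ.
apply: (lin_eq_pos (lin_comp (bp_lin bQ) (bp_lin bP)) (bp_lin bP)) => f f0 /=.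
have Pf0 := bp_pos bP f0; apply: vle_anti; first exact: (bp_le bQ Pf0).
by rewrite -{1}(bp_idem bP); apply: le_PQ.
Qed.

Lemma bp_solid P f g : bp P -> 0 <== f -> f <== P g -> P f = f.
Proof.
move=> bP f0 le_f; apply: vle_anti; first exact: bp_le.
have := bp_mono (bp_compl bP) le_f; rewrite (bp_idem bP) subrr => H.
by lin H.
Qed.

Lemma lin_cesaro T x n : is_linear T -> T (cesaro x n) = cesaro (fun k => T (x k)) n.
Proof. by move=> linT; rewrite /cesaro (linZ linT) (linS linT). Qed.

Lemma eq_cesaro x y n : (forall k, x k = y k) -> cesaro x n = cesaro y n.
Proof. by move=> eq_xy; congr (_ *: _); apply: eq_bigr => k _. Qed.

Lemma lin_sum (F : nat -> E -> E) n :
  (forall k, is_linear (F k)) -> is_linear (fun f => \sum_(k < n) F k f).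
Proof.
by move=> linF a f g; rewrite scaler_sumr -big_split; apply: eq_bigr => k _; apply: linF.
Qed.

Lemma lin_scale (T : E -> E) (a : R) : is_linear T -> is_linear (fun f => a *: T f).
Proof. by move=> linT b f g; rewrite linT; vec. Qed.

(** * Band projections and a weak order unit *)

Section WeakUnit.
Context (e : E) (unit_e : weak_order_unit le e).

Lemma unit_ge0 : 0 <== e. Proof. by case: unit_e. Qed.

Lemma inf2_unit_eq0 f : 0 <== f -> inf2 le f e = 0 -> f = 0.
Proof. by move=> f0 fe0; case: unit_e => _; apply; rewrite abs_id. Qed.

(** The infimum of [P f] and [e] is fixed by [P], being below [P f], and is therefore at most
    [P e]. *)
Lemma bp_eq0 P f : bp P -> P e <== 0 -> 0 <== f -> P f = 0.
Proof.
move=> bP Pe0 f0; have Pf0 := bp_pos bP f0; apply: (inf2_unit_eq0 Pf0).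
have z0 := inf2_ge0 Pf0 unit_ge0; apply: vle_anti => //.
rewrite -(bp_solid bP z0 (inf2_lel _ _)).
exact: vle_trans (bp_mono bP (inf2_ler _ _)) Pe0.
Qed.

(* Positivity of a combination of band projections can be tested on the unit:
   split along each [Rs k] in turn until only a scalar is left. *)
Lemma bp_comb_ge0 (Rs : nat -> E -> E) (a : nat -> R) n (c : R) Q :
  (forall k, bp (Rs k)) -> bp Q -> 0 <== Q (c *: e + \sum_(k < n) a k *: Rs k e) ->
  forall f, 0 <== f -> 0 <== Q (c *: f + \sum_(k < n) a k *: Rs k f).
Proof.
move=> bRs; elim: n c Q => [|n IHn] c Q bQ Ze f f0.
  move: Ze; rewrite !big_ord0 !addr0 !(linZ (bp_lin bQ)) => cQe.
  case: (leP 0 c) => [c0|c0]; first exact: vscale_ge0 c0 (bp_pos bQ f0).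
  have Nc : 0 < - c by rewrite oppr_gt0.
  rewrite (bp_eq0 bQ _ f0) ?scaler0; first exact: vle_refl.
  by apply: (vle_unscale Nc); lin cQe.
have bRn := bRs n; have linQ := bp_lin bQ; have linRn := bp_lin bRn.
have bQR := bp_comp bQ bRn; have bQC := bp_comp bQ (bp_compl bRn).
move: Ze; rewrite !(vsum_recr n (fun k => a k *: Rs k _)).
set ze := \sum_(k < n) _; set zf := \sum_(k < n) _ => Ze.
have -> : Q (c *: f + (zf + a n *: Rs n f)) =
    Q (Rs n ((c + a n) *: f + zf)) + Q ((c *: f + zf) - Rs n (c *: f + zf)).
  by rewrite -(linD linQ); congr (Q _); rewrite !(linD linRn) !(linZ linRn); vec.
have QRe : Q (Rs n e) = Rs n (Q e) := bp_comm bQ bRn e.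
have QRz : Q (Rs n ze) = Rs n (Q ze) := bp_comm bQ bRn ze.
rewrite !(linD linQ) !(linZ linQ) in Ze.
apply: vle_addge0; [apply: (IHn (c + a n) _ bQR)|apply: (IHn c _ bQC)] => //.
  have := bp_pos bRn Ze.
  rewrite !(linD linRn) !(linZ linRn) !(linD linQ) !(linZ linQ) QRe QRz bp_idem // => H.
  by lin H.
have := bp_pos (bp_compl bRn) Ze => /=.
rewrite -/ze (linB linQ) !(linD linRn) !(linZ linRn) !(linD linQ) !(linZ linQ) QRe QRz bp_idem // => H.
by lin H.
Qed.

(** * A Koopman-von Neumann lemma *)

Section KoopmanVonNeumann.
Context (f : nat -> E) (f0 : forall n, 0 <== f n).
Context (p : nat -> E) (null_p : vnull p) (cesaro_f : forall n, cesaro f n <== p n).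

Let h (m : nat) : R := 2^-1 ^+ m.

Let h_gt0 m : 0 < h m. Proof. by rewrite exprn_gt0 // invr_gt0. Qed.
Let h_ge0 m : 0 <= h m. Proof. exact: ltW. Qed.
Let hS m : h m = 2 * h m.+1.
Proof. by rewrite /h exprS mulrA mulfV ?mul1r ?pnatr_eq0. Qed.
Let h_le m n : (m <= n)%N -> h n <= h m.
Proof. by move=> le_mn; apply: ler_wiXn2l; rewrite ?invr_ge0 ?invf_le1 ?ler1n. Qed.

(** The band where a square root of [p n] would exceed [h m]. It shrinks with [n] and grows with
    [m]. *)
Let B n m := pspan (p n - h m ^+ 2 *: e).

Let bpB n m : bp (B n m). Proof. exact: pspan_bp. Qed.

Let B_dec n m g : 0 <== g -> B n.+1 m g <== B n m g.
Proof. by apply: pspan_le; apply: vle_add2r; case: null_p. Qed.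

Let B_inc n m k g : (m <= k)%N -> 0 <== g -> B n m g <== B n k g.
Proof.
move=> le_mk; apply: pspan_le.
have hh : h k ^+ 2 <= h m ^+ 2 by rewrite lerXn2r ?nnegrE ?h_le.
by lin (vle_scalel hh unit_ge0).
Qed.

(** Chebyshev's inequality: on its band, [h m ^+ 2 *: e] is below [p n]. A lower bound is therefore
    tested through its positive part cut off at [e], which suffices for a weak order unit. *)
Let B_null m g : 0 <== g -> vnull (fun n => B n m g).
Proof.
move=> g0; apply: vnull_intro => [n|n|u le_u]; [exact: B_dec|exact: bp_pos|].
apply: vle_trans (le_vpos u) _.
rewrite (inf2_unit_eq0 (vpos_ge0 u)); first exact: vle_refl.
have y0 := inf2_ge0 (vpos_ge0 u) unit_ge0; apply: vle_anti => //.
set y := inf2 le _ _ in y0 *.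
have hi0 : 0 <= (h m ^+ 2)^-1 by rewrite invr_ge0 exprn_ge0.
apply: (vnull_lb (vnullZ hi0 null_p)) => n.
have yB : y <== B n m g.
  apply: vle_trans (inf2_lel _ _) _; apply: sup2_le (le_u n) _; exact: bp_pos.
rewrite -(bp_solid (bpB n m) y0 yB).
apply: vle_trans (bp_mono (bpB n m) (inf2_ler _ _)) _.
apply: (vle_unscale (a := h m ^+ 2)); first by rewrite exprn_gt0.
have h2 : h m ^+ 2 != 0 by rewrite expf_neq0 // gt_eqF.
rewrite [X in _ <== X]scalerA (mulfV h2) scale1r.
apply: vle_trans (bp_le (bpB n m) (vnull_ge0 n null_p)).
have := pspan_ge0 (p n - h m ^+ 2 *: e).
rewrite -/(B n m) (linB (bp_lin (bpB n m))) (linZ (bp_lin (bpB n m))) => H.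
by lin H.
Qed.

(* [W n M], multiplication by a dyadic step function comparable with the
   square root of [p n], truncated at the level [h M]. *)
Let W n M g := \sum_(m < M) h m *: B n m g + (2 * h M) *: g.

Let W_lin n M : is_linear (W n M).
Proof.
have linS : is_linear (fun g => \sum_(m < M) h m *: B n m g).
  by apply: (lin_sum (F := fun m g => h m *: B n m g)) => m; apply/lin_scale/bp_lin.
by move=> a x y; rewrite /W linS; vec.
Qed.

Let W_pos n M : positive_op le (W n M).
Proof.
move=> g g0; apply: vle_addge0; last by apply: vscale_ge0; rewrite ?mulr_ge0.
by apply: (@vsum_ge0 M (fun m => h m *: B n m g)) => m; apply: vscale_ge0 => //; apply: bp_pos.
Qed.

Let W_recr n M g : W n M.+1 g = W n M g + h M *: (B n M g - g).
Proof. by rewrite /W (vsum_recr M (fun m => h m *: B n m g)) (hS M); cbv beta; vec. Qed.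

Let W_decM n M g : 0 <== g -> W n M.+1 g <== W n M g.
Proof.
by move=> g0; rewrite W_recr; lin (vle_scale (h_ge0 M) (bp_le (bpB n M) g0)).
Qed.

Let W_dec n M g : 0 <== g -> W n.+1 M g <== W n M g.
Proof.
move=> g0; apply: vle_add2r.
apply: (@vsum_le M (fun m => h m *: B n.+1 m g) (fun m => h m *: B n m g)) => m _.
by apply: vle_scale => //; apply: B_dec.
Qed.

(** At a fixed truncation [M] the sum tends to zero with [n], so a lower bound of the diagonal is at
    most [(2 * h M) *: g] for every [M], and the Archimedean property ends the argument. *)
Let W_null g : 0 <== g -> vnull (fun n => W n n g).
Proof.
move=> g0; apply: vnull_intro => [n|n|u le_u].
- exact: vle_trans (W_decM _ _ g0) (W_dec _ _ g0).
- exact: W_pos.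
have le_M M : u <== (2 * h M) *: g.
  have sum_null : vnull (fun n => \sum_(m < M) h m *: B n m g).
    exact: (vnull_sum M (fun m => vnullZ (h_ge0 m) (B_null m g0))).
  suff: u - (2 * h M) *: g <== 0 by move=> H; lin H.
  apply: (vnull_lb sum_null) => n.
  suff: u <== W n M g by rewrite /W => H; lin H.
  apply: vle_trans (le_u (maxn n M)) _.
  apply: (vle_trans (y := W (maxn n M) M g)).
    by apply: (decr_le (p := fun k => W (maxn n M) k g)) (leq_maxr n M) => k; apply: W_decM.
  by apply: (decr_le (p := fun k => W k M g)) (leq_maxl n M) => k; apply: W_dec.
apply: (archimedean (x := 2 *: g)) => n.
apply: vle_trans (le_M n) _; rewrite mulrC -scalerA; apply: vle_scalel.
  rewrite /h exprVn lef_pV2 ?posrE ?exprn_gt0 ?ltr0n //.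
  by rewrite -natrX ler_nat ltn_expl.
exact: vscale_ge0.
Qed.

Let s n := W n n e.
Let Rs k := pspan (f k - s k).

Let bpR k : bp (Rs k). Proof. exact: pspan_bp. Qed.

Let s_null : vnull s. Proof. exact: W_null unit_ge0. Qed.

Let cesaro_s n : cesaro (fun k => Rs k (s n)) n <== p n.
Proof.
apply: vle_trans (cesaro_f n); apply: cesaro_le => k lt_kn.
apply: vle_trans (bp_mono (bpR k) (vnull_le s_null (ltnW lt_kn))) _.
apply: vle_trans (bp_le (bpR k) (f0 k)).
have := pspan_ge0 (f k - s k); rewrite -/(Rs k) (linB (bp_lin (bpR k))) => H.
by lin H.
Qed.

Let bp_W D n M g : bp D -> D (W n M g) = W n M (D g).
Proof.
move=> bD; have linD' := bp_lin bD.
rewrite /W (linD linD') (linZ linD') (linS linD' M (fun m => h m *: B n m g)).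
by congr (_ + _); apply: eq_bigr => m _; rewrite (linZ linD') (bp_comm bD).
Qed.

(** On the piece [D], [W n n] is the scalar [h m] and [p n] is at most [h m ^+ 2 *: e]. So
    [cesaro_s] bounds [h m] times the mean at [e] by [h m ^+ 2]; one factor cancels, and
    [bp_comb_ge0] carries the result from [e] to [g]. *)
Let piece_le n m D g : (m < n)%N -> bp D ->
  (forall j x, (j <= m)%N -> B n j (D x) = 0) ->
  (forall j x, (m < j < n)%N -> B n j (D x) = D x) ->
  0 <== g -> 0 <== D (W n n g - cesaro (fun k => Rs k g) n).
Proof.
move=> lt_mn bD B0 B1 g0; have linD' := bp_lin bD.
have WD x : W n n (D x) = h m *: D x.
  (* At [M = m.+1] only the tail [2 * h m.+1] survives, and this is [h m]. Beyond it every [B n M]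
     is the identity on the piece, so the new summand makes up exactly for the halved tail. *)
  have WDM M : (m < M <= n)%N -> W n M (D x) = h m *: D x.
    elim: M => // M IHM /andP[lt_mM lt_Mn]; case: (ltnP m M) => [lt|le_Mm].
      rewrite (W_recr n M (D x)) IHM; last by rewrite lt ltnW.
      by rewrite (B1 M x) ?subrr ?scaler0 ?addr0; last by rewrite lt.
    have -> : M = m by apply/eqP; rewrite eqn_leq le_Mm -ltnS.
    rewrite /W big1 => [|j _]; first by rewrite add0r -hS.
    by rewrite (B0 j x) ?scaler0; last by rewrite -ltnS ltn_ord.
  by apply: WDM; rewrite lt_mn /=.
have Dp : D (p n) <== h m ^+ 2 *: D e.
  have := bp_mono bD (pspan_compl_le0 (p n - h m ^+ 2 *: e)).
  rewrite -/(B n m) (linB linD') (bp_comm bD (bpB n m)) (B0 m _ (leqnn m)).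
  rewrite (lin0 linD') (linB linD') (linZ linD') => H.
  by lin H.
have DU x : D (cesaro (fun k => Rs k x) n) = cesaro (fun k => Rs k (D x)) n.
  by rewrite (lin_cesaro _ _ linD'); apply: eq_cesaro => k; apply: bp_comm.
have Ds : D (s n) = h m *: D e by rewrite /s bp_W.
have Us : h m *: D (cesaro (fun k => Rs k e) n) <== h m *: (h m *: D e).
  have := vle_trans (bp_mono bD (cesaro_s n)) Dp.
  rewrite !DU Ds scalerA -expr2 -cesaroZ; congr le; apply: eq_cesaro => k.
  exact: linZ (bp_lin (bpR k)) _ _.
have Ue := vle_unscale (h_gt0 m) Us.
have combE x : h m *: x + \sum_(k < n) (- n%:R^-1) *: Rs k x
             = h m *: x - cesaro (fun k => Rs k x) n.
  by rewrite /cesaro -scaler_sumr scaleNr.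
have := @bp_comb_ge0 Rs (fun=> - n%:R^-1) n (h m) D bpR bD _ g g0.
rewrite !combE !(linB linD') !(linZ linD') bp_W // WD; apply.
by move: Ue; rewrite /cesaro (linZ linD') => Ue; lin Ue.
Qed.

(** As the level bands increase, [E] splits into the first band, the successive differences and the
    complement of the last one; the inequality is checked on each. *)
Let U_le_W n g : 0 <== g -> cesaro (fun k => Rs k g) n <== W n n g.
Proof.
move=> g0; case: n => [|n].
  by rewrite /cesaro invr0 scale0r; apply: W_pos.
set z := W n.+1 n.+1 g - cesaro (fun k => Rs k g) n.+1.
have absorb j m x : (j <= m)%N -> B n.+1 m (B n.+1 j x) = B n.+1 j x.
  by move=> le_jm; apply: bp_absorb => // y y0; apply: B_inc.
have Bz M : (M < n.+1)%N -> 0 <== B n.+1 M z.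
  elim: M => [_|m IHm lt_mn].
    (* On the first band no level bounds [p n.+1], but there [W] is the scalar 2, while a mean of
       projections is at most the identity. *)
    rewrite (linB (bp_lin (bpB n.+1 0))).
    have le1 : cesaro (fun k => Rs k g) n.+1 <== g.
      apply: vle_trans (cesaro_const_le n.+1 g0); apply: cesaro_le => k _.
      exact: bp_le.
    have WB0 M : W n.+1 M (B n.+1 0 g) = 2 *: B n.+1 0 g.
      elim: M => [|M IHM]; first by rewrite /W big_ord0 add0r /h expr0 mulr1.
      by rewrite W_recr IHM absorb // subrr scaler0 addr0.
    rewrite bp_W // WB0.
    by lin (vle_add (bp_mono (bpB n.+1 0) le1) (bp_pos (bpB n.+1 0) g0)).
  have -> : B n.+1 m.+1 z = B n.+1 m z + B n.+1 m.+1 (z - B n.+1 m z).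
    by rewrite (linB (bp_lin (bpB n.+1 m.+1)) z (B n.+1 m z)) absorb //; vec.
  apply: vle_addge0; first by apply: IHm; apply: ltnW.
  apply: (piece_le (m := m) (D := fun x => B n.+1 m.+1 (x - B n.+1 m x))) => //.
  - exact: ltnW.
  - exact: bp_comp (bpB n.+1 m.+1) (bp_compl (bpB n.+1 m)).
  - move=> j x le_jm; rewrite (bp_comm (bpB n.+1 j)) // (linB (bp_lin (bpB n.+1 j))).
    rewrite (bp_comm (bpB n.+1 j) (bpB n.+1 m)) absorb // subrr.
    exact: lin0 (bp_lin _).
  - by move=> j x /andP[lt_mj _]; rewrite absorb.
have -> : W n.+1 n.+1 g = cesaro (fun k => Rs k g) n.+1 + (B n.+1 n z + (z - B n.+1 n z)).
  by rewrite [X in _ + X]addrC subrK /z; vec.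
suff Cz : 0 <== z - B n.+1 n z by lin (vle_add (Bz n (ltnSn n)) Cz).
apply: (piece_le (m := n) (D := fun x => x - B n.+1 n x)) => //.
- exact: bp_compl.
- move=> j x le_jn; rewrite (linB (bp_lin (bpB n.+1 j))).
  by rewrite (bp_comm (bpB n.+1 j) (bpB n.+1 n)) absorb // subrr.
- by move=> j x /andP[lt_nj]; rewrite ltnS leqNgt lt_nj.
Qed.

Lemma koopman_von_neumann : exists Qs : nat -> E -> E, density_zero le Qs /\
  oconv le (fun n => f n - Qs n (f n)) 0.
Proof.
exists Rs; split; last first.
  apply: (oconv0I s_null) => n; first exact/vle_sub/bp_le/f0.
  have linRn := bp_lin (bpR n).
  have := vle_add (pspan_compl_le0 (f n - s n)) (bp_pos (bpR n) (vnull_ge0 n s_null)).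
  rewrite -/(Rs n) (linB linRn) => H.
  by lin H.
split; first by move=> n; apply: bp_band_projection.
exists (fun n g => W n n g); split.
- by move=> n; split; [apply: W_lin|apply: (pos_order_bounded (W_lin n n) (W_pos n n))].
- by move=> n g; apply: W_pos.
- by move=> n g g0; apply: vle_trans (W_decM _ _ g0) (W_dec _ _ g0).
- move=> V _ _ le_VW g g0; apply: (vnull_lb (W_null g0)) => n; exact: le_VW.
move=> n; split=> g g0; have := U_le_W n g0; rewrite /cesaro => H; first by lin H.
have U0 : 0 <== cesaro (fun k => Rs k g) n by apply: cesaro_ge0 => k; apply: bp_pos.
by have := vle_add U0 (W_pos n n g0); rewrite /cesaro => H'; lin H'.
Qed.

End KoopmanVonNeumann.

(** * Decreasing sequences of operators and the converse *)

Lemma decreasing_operators_null (W : nat -> E -> E) :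
    (forall n, is_linear (W n)) -> (forall n, positive_op le (W n)) ->
    (forall n g, 0 <== g -> W n.+1 g <== W n g) ->
    (forall V, is_linear V -> order_bounded le V -> (forall n, op_le le V (W n)) ->
       op_le le V (fun=> 0)) ->
  forall g, 0 <== g -> vnull (fun n => W n g).
Proof.
move=> linW posW decW infW.
pose phi g := vinf (fun y => exists n, y = W n g).
have infphi g : 0 <== g -> is_inf le (fun y => exists n, y = W n g) (phi g).
  move=> g0; apply: (vinfP (x := W 0%N g) (u := 0)); first by exists 0%N.
  by move=> _ [n ->]; apply: posW.
have phi_le n g : 0 <== g -> phi g <== W n g.
  by move=> g0; have [lb _] := infphi g g0; apply: lb; exists n.
have phi_glb u g : 0 <== g -> (forall n, u <== W n g) -> u <== phi g.
  by move=> g0 le_u; have [_ glb] := infphi g g0; apply: glb => _ [n ->].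
have phi_ge0 g : 0 <== g -> 0 <== phi g by move=> g0; apply: (phi_glb) => // n; apply: posW.
have phiD f g : 0 <== f -> 0 <== g -> phi (f + g) = phi f + phi g.
  move=> f0 g0; have fg0 := vle_addge0 f0 g0; apply: vle_anti; last first.
    by apply: (phi_glb) => // n; rewrite (linD (linW n)); apply: vle_add; apply: phi_le.
  suff: phi (f + g) - phi f <== phi g by move=> H; lin H.
  apply: (phi_glb) => // m.
  suff: phi (f + g) - W m g <== phi f by move=> H; lin H.
  apply: (phi_glb) => // n.
  (* The infima at [f] and at [g] run over independent indices; monotonicity moves both to the
     larger one, where [W] is additive. *)
  have le1 := decr_le (p := fun k => W k f) (fun k => decW k f f0) (leq_maxl n m).
  have le2 := decr_le (p := fun k => W k g) (fun k => decW k g g0) (leq_maxr n m).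
  have := phi_le (maxn n m) _ fg0; rewrite (linD (linW _)) => le3.
  by lin (vle_add le3 (vle_add le1 le2)).
have phiZ (a : R) f : 0 <= a -> 0 <== f -> phi (a *: f) = a *: phi f.
  rewrite le_eqVlt => /orP[/eqP <- _|a0 f0].
    rewrite !scale0r; apply: vle_anti; last exact/phi_ge0/vle_refl.
    by apply: vle_trans (phi_le 0%N _ (vle_refl 0)) _; rewrite (lin0 (linW 0%N)); apply: vle_refl.
  have af0 := vscale_ge0 (ltW a0) f0; apply: vle_anti; last first.
    by apply: (phi_glb) => // n; rewrite (linZ (linW n)); apply/vle_scale/phi_le/f0/ltW.
  apply: (vle_unscale (a := a^-1)); first by rewrite invr_gt0.
  rewrite [X in _ <== X]scalerA mulVf ?gt_eqF // scale1r.
  apply: (phi_glb) => // n; apply: (vle_unscale a0).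
  by rewrite scalerA mulfV ?gt_eqF // scale1r -(linZ (linW n)); apply: phi_le.
(* The hypothesis on the infimum speaks only of linear order bounded operators on all of [E], so
   [phi] has to be extended before it can be compared with [0]. *)
have linV := cone_ext_linear phiD phiZ.
have VE g : 0 <== g -> cone_ext phi g = phi g by apply: cone_extE.
have posV : positive_op le (cone_ext phi) by move=> g g0; rewrite VE //; apply: phi_ge0.
move=> g g0; apply: vnull_intro => [n|n|u le_u]; [exact: decW|exact: posW|].
apply: vle_trans (phi_glb _ _ g0 le_u) _; rewrite -VE //.
apply: infW g0 => //; first exact: pos_order_bounded linV posV.
by move=> n f f0; rewrite VE //; apply: phi_le.
Qed.

(** On the band of [Qs k] the uniform bound [C] is used, off it the null sequence [q]: [f k] is at
    most [C *: Qs k e + q k], and both parts have null Cesaro means. *)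
Lemma koopman_von_neumann_converse (f : nat -> E) (C : R) (Qs : nat -> E -> E) :
    (forall n, 0 <== f n) -> (forall n, f n <== C *: e) -> 0 <= C ->
    density_zero le Qs -> oconv le (fun n => f n - Qs n (f n)) 0 ->
  exists2 p, vnull p & forall n, cesaro f n <== p n.
Proof.
move=> f0 fC C0 [bpQs [W [linW posW decW infW domW]]] /oconv0E[q nq le_q].
have bQ n : bp (Qs n) by apply: band_projection_bp.
have [r nr le_r] := cesaro_null nq.
have nW := decreasing_operators_null (fun n => proj1 (linW n)) posW decW infW unit_ge0.
exists (fun n => C *: W n e + r n); first exact: vnullD (vnullZ C0 nW) nr.
move=> n; apply: (vle_trans (y := cesaro (fun k => C *: Qs k e + q k) n)).
  apply: cesaro_le => k _.
  have := bp_mono (bQ k) (fC k); rewrite (linZ (bp_lin (bQ k))) => le1.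
  by lin (vle_add le1 (vle_trans (le_abs _) (le_q k))).
rewrite cesaroD cesaroZ; apply: vle_add => //; apply: vle_scale => //.
have [le_W _] := domW n; have := le_W e unit_ge0.
by rewrite subr0.
Qed.

(** * Freudenthal approximation *)

(* Combinations with nonnegative coefficients suffice, and keep the products of
   approximants positive. *)
Inductive psimple : E -> Prop :=
  | psimple0 : psimple 0
  | psimpleD a P f : 0 <= a -> bp P -> psimple f -> psimple (a *: P e + f).

Lemma psimple_bp P f : bp P -> psimple f -> psimple (P f).
Proof.
move=> bP; elim=> [|a Q g a0 bQ _ IHg]; first by rewrite (lin0 (bp_lin bP)); constructor.
rewrite (bp_lin bP); exact: psimpleD a0 (bp_comp bP bQ) IHg.
Qed.

(** Peels off one layer of height [eps]: where [f] exceeds [eps *: e], this amount is subtracted and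
    the rest is approximated by induction; elsewhere [f] is already within [eps *: e] of [0]. *)
Lemma freudenthal (eps : R) N f : 0 < eps -> 0 <== f -> f <== (N%:R * eps) *: e ->
  exists s, [/\ psimple s, 0 <== f - s & f - s <== eps *: e].
Proof.
move=> eps0; elim: N f => [|N IHN] f f0 le_f.
  exists 0; rewrite subr0; split=> //; first exact: psimple0.
  apply: vle_trans le_f _; rewrite mul0r scale0r; apply: vscale_ge0 unit_ge0; exact: ltW.
set z := f - eps *: e; set P := pspan z.
have bP : bp P := pspan_bp z; have linP := bp_lin bP.
have zN : vpos z <== (N%:R * eps) *: e.
  apply: sup2_le; last by apply: vscale_ge0 unit_ge0; rewrite mulr_ge0 // ltW.
  by rewrite /z; move: le_f; rewrite -natr1 => H; lin H.
have [s [ss s0 le_s]] := IHN _ (vpos_ge0 z) zN.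
exists (eps *: P e + P s); split.
- exact: psimpleD (ltW eps0) bP (psimple_bp bP ss).
- have le1 := bp_pos bP s0; have le2 := bp_pos (bp_compl bP) f0.
  rewrite (linB linP) -(pspan_self z) bp_idem // -/P /z (linB linP) (linZ linP) in le1.
  by lin (vle_add le1 le2).
have le1 := bp_mono bP le_s; have le2 := pspan_compl_le0 z.
rewrite (linB linP) -(pspan_self z) bp_idem // -/P /z (linB linP) (linZ linP) in le1.
rewrite -/P /z (linB linP) (linZ linP) in le2.
by lin (vle_add le1 le2).
Qed.

Lemma e_bounded_lin (a : R) f g : e_bounded le e f -> e_bounded le e g -> e_bounded le e (a *: f + g).
Proof.
move=> [k [k0 fk]] [l [l0 gl]]; exists (`|a| * k + l).
split; first by rewrite addr_ge0 ?mulr_ge0.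
apply: vle_trans (absD _ _) _.
have a0 : 0 <= `|a| by [].
by lin (vle_add (vle_trans (absZ a f) (vle_scale a0 fk)) gl).
Qed.

Lemma e_bounded0 : e_bounded le e 0.
Proof. by exists 0; split=> //; rewrite scale0r abs_id; apply: vle_refl. Qed.

Lemma bp_unit_le P : bp P -> abs (P e) <== 1 *: e.
Proof.
move=> bP; rewrite scale1r abs_id; last exact: bp_pos unit_ge0.
exact: bp_le unit_ge0.
Qed.

Lemma e_bounded_bp P : bp P -> e_bounded le e (P e).
Proof. by move=> bP; exists 1; split=> //; apply: bp_unit_le. Qed.

Lemma e_bounded_psimple s : psimple s -> e_bounded le e s.
Proof.
elim=> [|a P f _ bP _ bf]; first exact: e_bounded0.
exact: e_bounded_lin (e_bounded_bp bP) bf.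
Qed.

Lemma psimple_ge0 s : psimple s -> 0 <== s.
Proof.
elim=> [|a P f a0 bP _ f0]; first exact: vle_refl.
exact: vle_addge0 (vscale_ge0 a0 (bp_pos bP unit_ge0)) f0.
Qed.

Lemma psimple_approx (k eps : R) f : 0 < eps -> 0 <== f -> f <== k *: e ->
  exists s, [/\ psimple s, 0 <== f - s & f - s <== eps *: e].
Proof.
move=> eps0 f0 fk; apply: (freudenthal (N := Num.bound `|k / eps|) eps0 f0).
apply: vle_trans fk (vle_scalel _ unit_ge0); rewrite -ler_pdivrMr //.
exact: le_trans (ler_norm _) (ltW (archi_boundP (normr_ge0 _))).
Qed.

(** A density principle. Adding [k *: e] makes [f] positive, so that Freudenthal approximation
    applies; the shift is undone by linearity, [e] being itself of the form [P e]. *)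
Lemma e_bounded_ind (C : E -> Prop) :
    (forall P, bp P -> C (P e)) ->
    (forall (a : R) f g, e_bounded le e f -> e_bounded le e g -> C f -> C g ->
       C (a *: f + g)) ->
    (forall f, e_bounded le e f ->
       (forall m, exists g, [/\ e_bounded le e g, C g & abs (f - g) <== m.+1%:R^-1 *: e]) ->
       C f) ->
  forall f, e_bounded le e f -> C f.
Proof.
move=> Cbp Clin Clim f bf; have [k [k0 fk]] := bf.
have be : e_bounded le e e := e_bounded_bp bp_id.
have Ce : C e := Cbp _ bp_id.
have C0 : C 0.
  by have := Clin (-1) e e be be Ce Ce; rewrite scaleN1r addNr.
have Csimple s : psimple s -> C s.
  elim=> // a P g _ bP sg Cg; apply: Clin => //; last exact: Cbp.
    exact: e_bounded_bp.
  exact: e_bounded_psimple.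
apply: Clim bf _ => m; have eps0 : 0 < m.+1%:R^-1 :> R by rewrite invr_gt0.
have fk0 : 0 <== f + k *: e by lin (vle_trans (leN_abs f) fk).
have fk2 : f + k *: e <== (2 * k) *: e by lin (vle_trans (le_abs f) fk).
have [s [ss s0 le_s]] := psimple_approx eps0 fk0 fk2.
exists ((- k) *: e + s); split.
- exact: e_bounded_lin be (e_bounded_psimple ss).
- by apply: Clin => //; [apply: e_bounded_psimple|apply: Csimple].
have -> : f - (- k *: e + s) = f + k *: e - s by vec.
by rewrite abs_id.
Qed.

(** * The product of bounded elements *)

Section Product.
Context (mul : E -> E -> E) (multP : falg_mult le e mul).

Local Notation bounded := (e_bounded le e).

Lemma mul_linl (a : R) f g h : bounded f -> bounded g -> bounded h ->
  mul (a *: f + g) h = a *: mul f h + mul g h.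
Proof. by case: multP => linl _ _ _ _; apply: linl. Qed.

Lemma mul_linr (a : R) f g h : bounded f -> bounded g -> bounded h ->
  mul h (a *: f + g) = a *: mul h f + mul h g.
Proof. by case: multP => _ linr _ _ _; apply: linr. Qed.

Lemma mul_bp P Q : bp P -> bp Q -> mul (P e) (Q e) = P (Q e).
Proof. by case: multP => _ _ mulPQ _ _ bP bQ; apply: mulPQ; apply: bp_band_projection. Qed.

Lemma mul0l h : bounded h -> mul 0 h = 0.
Proof.
move=> bh; have := mul_linl (-1) e_bounded0 e_bounded0 bh.
by rewrite scaler0 addr0 scaleN1r addNr.
Qed.

Lemma mul0r h : bounded h -> mul h 0 = 0.
Proof.
move=> bh; have := mul_linr (-1) e_bounded0 e_bounded0 bh.
by rewrite scaler0 addr0 scaleN1r addNr.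
Qed.

Lemma mul_psimple_ge0 s t : psimple s -> psimple t -> 0 <== mul s t.
Proof.
move=> ss st; have bt := e_bounded_psimple st.
elim: ss => [|a P s' a0 bP ss' s't0]; first by rewrite mul0l //; apply: vle_refl.
have bPe := e_bounded_bp bP.
rewrite mul_linl //; last exact: e_bounded_psimple.
apply: vle_addge0 s't0; apply: vscale_ge0 => // {s' ss'}.
elim: st {bt} => [|b Q t' b0 bQ st' t'0]; first by rewrite mul0r //; apply: vle_refl.
have bQe := e_bounded_bp bQ; have bt' := e_bounded_psimple st'.
rewrite mul_linr // mul_bp //.
apply: vle_addge0 t'0; apply: vscale_ge0 => //.
exact: (bp_pos bP (bp_pos bQ unit_ge0)).
Qed.

Lemma psimple_seq (k : R) f : 0 <== f -> f <== k *: e ->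
  exists s : nat -> E, [/\ forall n, psimple (s n), forall n, abs (s n) <== k *: e & oconv le s f].
Proof.
move=> f0 fk.
have approx n : exists s, [/\ psimple s, 0 <== f - s & f - s <== n.+1%:R^-1 *: e].
  by apply: psimple_approx f0 fk; rewrite invr_gt0.
pose s n := epsilon (inhabits 0)
  (fun s => [/\ psimple s, 0 <== f - s & f - s <== n.+1%:R^-1 *: e]).
have sP n : [/\ psimple (s n), 0 <== f - s n & f - s n <== n.+1%:R^-1 *: e].
  exact: epsilon_spec (approx n).
exists s; split=> [n|n|].
- by case: (sP n).
- have [ss s0 _] := sP n; rewrite abs_id; last exact: psimple_ge0.
  by apply: vle_trans (vsub_le s0) fk.
have [dec inf] := vnull_inv unit_ge0.
exists (fun n => n.+1%:R^-1 *: e); split=> // n.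
by have [_ s0 le_s] := sP n; rewrite -absN opprB abs_id.
Qed.

(** Positivity is known for simple elements and survives an iterated limit, one variable at a time,
    by order continuity of the product. *)
Lemma mul_ge0 f g : bounded f -> bounded g -> 0 <== f -> 0 <== g -> 0 <== mul f g.
Proof.
move=> bf bg f0 g0.
have [k [k0 fk]] := bf; have [l [l0 gl]] := bg.
have [s [ss sk cs]] := psimple_seq f0 (vle_trans (le_abs f) fk).
have [t [st tl ct]] := psimple_seq g0 (vle_trans (le_abs g) gl).
have [_ _ _ contl contr] := multP.
apply: oconv_ge0 (contr t g f l tl bg bf ct) => m.
apply: oconv_ge0 (contl s f (t m) k sk bf (e_bounded_psimple (st m)) cs) => n.
exact: mul_psimple_ge0.
Qed.

(** Expand the positive products of [a *: e + c *: f] and [b *: e + d *: g] for signs [c], [d].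
    Averaging the two with opposite signs, or the two with equal signs, cancels the cross terms and
    bounds [mul f g] from above, or from below. *)
Lemma mul_bound (a b : R) f g : 0 <= a -> 0 <= b ->
  abs f <== a *: e -> abs g <== b *: e -> abs (mul f g) <== (a * b) *: e.
Proof.
move=> a0 b0 fa gb.
have bf : bounded f by exists a.
have bg : bounded g by exists b.
have be : bounded e := e_bounded_bp bp_id.
have ee : mul e e = e := mul_bp bp_id bp_id.
have signed (c d : R) : `|c| <= 1 -> `|d| <= 1 -> 0 <==
    (a * b) *: e + (a * d) *: mul e g + (c * b) *: mul f e + (c * d) *: mul f g.
  move=> c1 d1.
  have nonneg (x y : R) h : `|x| <= 1 -> abs h <== y *: e -> 0 <== x *: h + y *: e.
    move=> x1 hy; have xh : abs (x *: h) <== y *: e.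
      apply: vle_trans (absZ x h) _; apply: vle_trans hy.
      by rewrite -[X in _ <== X]scale1r; apply: vle_scalel (abs_ge0 h).
    by lin (vle_trans (leN_abs (x *: h)) xh).
  have bye y : bounded (y *: e).
    by rewrite -[y *: e]addr0; apply: e_bounded_lin be e_bounded0.
  have bxh x y h : bounded h -> bounded (x *: h + y *: e).
    by move=> bh; apply: e_bounded_lin.
  have mulZl y h : bounded h -> mul (y *: e) h = y *: mul e h.
    by move=> bh; rewrite -[y *: e]addr0 mul_linl ?mul0l ?addr0 //; apply: e_bounded0.
  have mulZr y h : bounded h -> mul h (y *: e) = y *: mul h e.
    by move=> bh; rewrite -[y *: e]addr0 mul_linr ?mul0r ?addr0 //; apply: e_bounded0.
  have := mul_ge0 (bxh c a f bf) (bxh d b g bg) (nonneg _ _ _ c1 fa) (nonneg _ _ _ d1 gb).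
  rewrite mul_linl ?mul_linr ?mulZl ?mulZr ?mul_linr ?mulZr ?ee //; do ?[exact: bxh].
  by move=> H; lin H.
have half0 : 0 <= 2^-1 :> R by rewrite invr_ge0.
have n1 : `|1 : R| <= 1 by rewrite normr1.
have nN1 : `|-1 : R| <= 1 by rewrite normrN1.
apply: abs_le.
  have := vle_scale half0 (vle_addge0 (signed _ _ n1 nN1) (signed _ _ nN1 n1)).
  by move=> H; apply: (vle_of H); vec; field.
have := vle_scale half0 (vle_addge0 (signed _ _ n1 n1) (signed _ _ nN1 nN1)).
by move=> H; apply: (vle_of H); vec; field.
Qed.

(** * Correlations of a conditional expectation preserving system *)

(** The trait shared by [T], [S] and the iterates of [S]: bounds by multiples of [e] are preserved,
    hence estimates on correlations are uniform in time. *)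
Definition unit_contraction (U : E -> E) := [/\ is_linear U, positive_op le U & U e = e].

Lemma contraction_abs U f (k : R) :
  unit_contraction U -> abs f <== k *: e -> abs (U f) <== k *: e.
Proof.
move=> [linU posU Ue] fk; apply: vle_trans (pos_abs linU posU f) _.
by rewrite -[X in _ <== _ *: X]Ue -(linZ linU); apply: (pos_mono linU posU).
Qed.

Lemma contraction_bounded U f : unit_contraction U -> bounded f -> bounded (U f).
Proof. by move=> cU [k [k0 fk]]; exists k; split=> //; apply: contraction_abs. Qed.

Lemma contraction_iter U n : unit_contraction U -> unit_contraction (iter n U).
Proof.
move=> [linU posU Ue]; elim: n => [|n [linI posI Ie]]; split=> //=.
- by move=> a f g /=; rewrite linI linU.
- by move=> f f0 /=; apply: (posU _ (posI _ f0)).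
- by rewrite Ie.
Qed.

Lemma riesz_hom_positive U : riesz_hom le U -> positive_op le U.
Proof.
move=> [linU supU] f f0; have := supU f 0; rewrite (lin0 linU) -/(vpos f) vpos_id // => ->.
exact: vpos_ge0.
Qed.

Section Correlation.
Context (T S : E -> E) (cT : unit_contraction T) (cS : unit_contraction S).

Definition correlation (n : nat) (f g : E) : E :=
  T (mul (iter n S f) g) - mul (T f) (T g).

Definition decorrelated (f g : E) : Prop :=
  exists2 p, vnull p & forall n, cesaro (fun k => abs (correlation k f g)) n <== p n.

Lemma decorrelatedP f g :
  oconv le (cesaro (fun k => abs (correlation k f g))) 0 <-> decorrelated f g.
Proof.
have c0 n : 0 <== cesaro (fun k => abs (correlation k f g)) n.
  by apply: cesaro_ge0 => k; apply: abs_ge0.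
split=> [/oconv0E[p np le_p]|[p np le_p]]; last exact: oconv0I np _ le_p.
by exists p => // n; apply: vle_trans (le_abs _) (le_p n).
Qed.

Lemma correlation_linl n (a : R) f g h : bounded f -> bounded g -> bounded h ->
  correlation n (a *: f + g) h = a *: correlation n f h + correlation n g h.
Proof.
move=> bf bg bh; have cI := contraction_iter n cS; have [linI _ _] := cI.
have [linT _ _] := cT; rewrite /correlation linI linT.
have bTf := contraction_bounded cT bf; have bTg := contraction_bounded cT bg.
have bTh := contraction_bounded cT bh.
have bIf := contraction_bounded cI bf; have bIg := contraction_bounded cI bg.
by rewrite !mul_linl // linT; vec.
Qed.

Lemma correlation_linr n (a : R) f g h : bounded f -> bounded g -> bounded h ->
  correlation n h (a *: f + g) = a *: correlation n h f + correlation n h g.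
Proof.
move=> bf bg bh; have cI := contraction_iter n cS.
have [linT _ _] := cT; rewrite /correlation linT.
have bTf := contraction_bounded cT bf; have bTg := contraction_bounded cT bg.
have bTh := contraction_bounded cT bh; have bIh := contraction_bounded cI bh.
by rewrite !mul_linr // linT; vec.
Qed.

Lemma correlation_bound n (a b : R) f g : 0 <= a -> 0 <= b ->
  abs f <== a *: e -> abs g <== b *: e ->
  abs (correlation n f g) <== (2 * (a * b)) *: e.
Proof.
move=> a0 b0 fa gb; have cI := contraction_iter n cS.
apply: vle_trans (absD _ _) _; rewrite absN.
have le1 := mul_bound a0 b0 (contraction_abs cI fa) gb.
have le2 := mul_bound a0 b0 (contraction_abs cT fa) (contraction_abs cT gb).
by lin (vle_add (contraction_abs cT le1) le2).
Qed.

Lemma cesaro_abs_lin (x y z : nat -> E) (a : R) (p q : nat -> E) :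
    (forall k, z k = a *: x k + y k) -> vnull p -> vnull q ->
    (forall n, cesaro (fun k => abs (x k)) n <== p n) ->
    (forall n, cesaro (fun k => abs (y k)) n <== q n) ->
  exists2 r, vnull r & forall n, cesaro (fun k => abs (z k)) n <== r n.
Proof.
move=> zE np nq xp yq; have a0 : 0 <= `|a| by [].
exists (fun n => `|a| *: p n + q n); first exact: vnullD (vnullZ a0 np) nq.
move=> n; apply: (vle_trans (y := cesaro (fun k => `|a| *: abs (x k) + abs (y k)) n)).
  apply: cesaro_le => k _; rewrite zE; apply: vle_trans (absD _ _) _.
  by apply: vle_add2r; apply: absZ.
by rewrite cesaroD cesaroZ; apply: vle_add => //; apply: vle_scale.
Qed.

Lemma decorrelated_linl (a : R) f g h : bounded f -> bounded g -> bounded h ->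
  decorrelated f h -> decorrelated g h -> decorrelated (a *: f + g) h.
Proof.
move=> bf bg bh [p np fp] [q nq gq]; apply: (cesaro_abs_lin _ np nq fp gq) => k.
exact: correlation_linl.
Qed.

Lemma decorrelated_linr (a : R) f g h : bounded f -> bounded g -> bounded h ->
  decorrelated h f -> decorrelated h g -> decorrelated h (a *: f + g).
Proof.
move=> bf bg bh [p np fp] [q nq gq]; apply: (cesaro_abs_lin _ np nq fp gq) => k.
exact: correlation_linr.
Qed.

(** An error uniform in [k] passes to the Cesaro means unchanged, so [vnull_approx] applies with the
    errors as its sequence [d]. *)
Lemma cesaro_abs_approx (x : nat -> E) (c : R) : 0 <= c ->
    (forall m, exists2 y : nat -> E,
       (exists2 p, vnull p & forall n, cesaro (fun k => abs (y k)) n <== p n) &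
       forall k, abs (x k - y k) <== (c * m.+1%:R^-1) *: e) ->
  exists2 p, vnull p & forall n, cesaro (fun k => abs (x k)) n <== p n.
Proof.
move=> c0 approx.
apply: (vnull_approx _ (vnull_inv (vscale_ge0 c0 unit_ge0))) => [n|m].
  by apply: cesaro_ge0 => k; apply: abs_ge0.
have [y [p np yp] xy] := approx m; exists p => // n.
have w0 : 0 <== (c * m.+1%:R^-1) *: e.
  by apply: vscale_ge0 unit_ge0; rewrite mulr_ge0 ?invr_ge0.
apply: (vle_trans (y := cesaro (fun k => abs (y k) + (c * m.+1%:R^-1) *: e) n)).
  apply: cesaro_le => k _; rewrite -[X in abs X <== _](subrK (y k)).
  by apply: vle_trans (absD _ _) _; rewrite addrC; apply: vle_add (vle_refl _) (xy k).
rewrite cesaroD scalerA (mulrC _ c); apply: vle_add => //; exact: cesaro_const_le.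
Qed.

Lemma decorrelated_liml f g : bounded f -> bounded g ->
    (forall m, exists h, [/\ bounded h, decorrelated h g &
       abs (f - h) <== m.+1%:R^-1 *: e]) ->
  decorrelated f g.
Proof.
move=> bf bg approx; have [b [b0 gb]] := bg.
apply: (cesaro_abs_approx (c := 2 * b)) => [|m]; first by rewrite mulr_ge0.
have [h [bh hg fh]] := approx m; exists (fun k => correlation k h g) => // k.
have m0 : 0 <= m.+1%:R^-1 :> R by rewrite invr_ge0.
have := correlation_bound k m0 b0 fh gb.
have -> : f - h = (-1) *: h + f by vec.
by rewrite correlation_linl // scaleN1r addrC -mulrA (mulrC b).
Qed.

Lemma decorrelated_limr f g : bounded f -> bounded g ->
    (forall m, exists h, [/\ bounded h, decorrelated f h &
       abs (g - h) <== m.+1%:R^-1 *: e]) ->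
  decorrelated f g.
Proof.
move=> bf bg approx; have [b [b0 fb]] := bf.
apply: (cesaro_abs_approx (c := 2 * b)) => [|m]; first by rewrite mulr_ge0.
have [h [bh hg gh]] := approx m; exists (fun k => correlation k f h) => // k.
have m0 : 0 <= m.+1%:R^-1 :> R by rewrite invr_ge0.
have := correlation_bound k b0 m0 fb gh.
have -> : g - h = (-1) *: h + g by vec.
by rewrite correlation_linr // scaleN1r addrC mulrA.
Qed.

Lemma decorrelated_bounded :
    (forall P Q, bp P -> bp Q -> decorrelated (P e) (Q e)) ->
  forall f g, bounded f -> bounded g -> decorrelated f g.
Proof.
move=> dPQ f g bf bg.
apply: (e_bounded_ind (C := fun f => decorrelated f g) _ _ _ bf) => {f bf}.
- move=> P bP; have bPe := e_bounded_bp bP.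
  apply: (e_bounded_ind (C := decorrelated (P e)) _ _ _ bg) => {g bg}.
  + by move=> Q bQ; apply: dPQ.
  + by move=> a f g bf bg; apply: decorrelated_linr.
  by move=> g bg; apply: decorrelated_limr.
- by move=> a f h bf bh; apply: decorrelated_linl.
by move=> f bf; apply: decorrelated_liml.
Qed.

End Correlation.
End Product.
End WeakUnit.

End RieszTheory.

Theorem theorem4p4 (R : realType) (E : lmodType R) (le : E -> E -> Prop)
    (e : E) (T S : E -> E) (mul : E -> E -> E) :
  riesz_space le -> dedekind_complete le -> weak_order_unit le e ->
  falg_mult le e mul -> ceps le T S e ->
  [<->
   (* (1) weak mixing *)
   (forall P Q, band_projection le P -> band_projection le Q ->
      oconv le (fun n => ((n%:R : R)^-1) *: \sum_(k < n)
          absv le (T (mul (iter k S (P e)) (Q e)) - mul (T (P e)) (T (Q e)))) 0);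
   (* (2) *)
   (forall f g, e_bounded le e f -> e_bounded le e g ->
      oconv le (fun n => ((n%:R : R)^-1) *: \sum_(k < n)
          absv le (T (mul (iter k S f) g) - mul (T f) (T g))) 0);
   (* (3) *)
   (forall P Q, band_projection le P -> band_projection le Q ->
      exists Rs : nat -> E -> E, density_zero le Rs /\
        oconv le (fun n =>
          absv le (T (mul (iter n S (P e)) (Q e)) - mul (T (P e)) (T (Q e)))
          - Rs n (absv le (T (mul (iter n S (P e)) (Q e)) - mul (T (P e)) (T (Q e))))) 0)].
Proof.
move=> riesz dedekind unit_e multP [[linT [posT _]] [Te [homS [_ [Se _]]]]].
have cT : unit_contraction le e T by [].
have cS : unit_contraction le e S.
  by split=> //; [case: homS|apply: riesz_hom_positive].
have decP := decorrelatedP riesz mul T S.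
have bpP P : band_projection le P -> bp le P by exact: (band_projection_bp riesz).
have bpE P : band_projection le P -> e_bounded le e (P e).
  by move=> bP; apply: (e_bounded_bp riesz unit_e); apply: bpP.
(* The cycle is (1) -> (2) -> (3) -> (1); the second implication uses (2) only at [P e] and [Q e],
   where it is (1). *)
tfae=> [mixing f g bf bg|mixing P Q bP bQ|dens P Q bP bQ].
- apply/decP; apply: (decorrelated_bounded riesz dedekind unit_e multP cT cS) => // P Q bP bQ.
  by apply/decP; apply: mixing; apply: bp_band_projection.
- have /decP[p np le_p] := mixing _ _ (bpE P bP) (bpE Q bQ).
  apply: (koopman_von_neumann riesz dedekind unit_e _ np le_p) => n.
  exact: abs_ge0.
have [Rs [dRs cRs]] := dens P Q bP bQ.
(* The constant is that of [correlation_bound] for two elements bounded by [1 *: e]. *)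
apply/decP; apply: (koopman_von_neumann_converse riesz dedekind unit_e (C := 2 * (1 * 1)) _ _ _ dRs cRs) => [n|n|].
- exact: abs_ge0.
- apply: (correlation_bound riesz dedekind unit_e multP cT cS) => //;
    exact: (bp_unit_le riesz unit_e (bpP _ _)).
by rewrite !mulr1.
Qed.
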